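(* Let $(\Sigma,\mathcal{F})$ be a measurable space and let $\mathfrak{X}=\mathcal{M}(\Sigma,\mathcal{F})$ be the Banach space of all bounded signed measures on $(\Sigma,\mathcal{F})$ with the total variation norm. Let $(\mathcal{U}(t))_{t\ge0}$ be a substochastic $C_0$-semigroup on $\mathfrak{X}$ with generator $\mathcal{A}$, $\mathcal{B}:\mathscr{D}(\mathcal{A})\to\mathfrak{X}$ a positive linear operator with $\langle\mathbf{\Psi},(\mathcal{A}+\mathcal{B})u\rangle\le0$ for all $u\in\mathscr{D}(\mathcal{A})\cap\mathfrak{X}_+$, let $(\mathcal{V}(t))_{t\ge0}$ be the associated minimal semigroup with generator $\mathcal{G}$, let $\mathcal{H}=\{u\in\mathfrak{X}_+:\langle\mathbf{\Xi}_\lambda,u\rangle=0\text{ for any }\lambda>0\}$ and $\mathscr{H}=\mathcal{H}-\mathcal{H}$. Then $\mathscr{H}$ is an $M$-ideal of $\mathfrak{X}$ and $\mathfrak{X}=\mathscr{H}\oplus\mathscr{H}_d$, where $$\mathscr{H}_d=\{\mu\in\mathcal{M}(\Sigma,\mathcal{F}) : \nu\prec\mu\text{ and }\nu\in\mathscr{H}\text{ imply }\nu=0\}.$$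
   Context: $\mathfrak{X}=\mathcal{M}(\Sigma,\mathcal{F})$ is ordered by the cone $\mathfrak{X}_+$ of nonnegative measures, $\|\mu\|=|\mu|(\Sigma)$, and $\langle\mathbf{\Psi},\mu\rangle=\mu(\Sigma)$, so that $\langle\mathbf{\Psi},\mu\rangle=\|\mu\|$ on $\mathfrak{X}_+$. For $\mu,\nu\in\mathfrak{X}$, $\nu\prec\mu$ means that $\nu$ is absolutely continuous with respect to $|\mu|$. A closed linear subspace $\mathscr{A}$ of $\mathfrak{X}$ is an $M$-ideal if $\mu\in\mathscr{A}$, $\nu\in\mathfrak{X}$ and $\nu\prec\mu$ imply $\nu\in\mathscr{A}$. A linear operator is positive if it maps positive elements of its domain into $\mathfrak{X}_+$. A $C_0$-semigroup $(T(t))_{t\ge0}$ is substochastic if each $T(t)$ is positive and $\|T(t)u\|\le\|u\|$ for $u\in\mathfrak{X}_+$. Minimal semigroup: under the stated hypotheses there is a smallest (for the operator order, for each $t$) substochastic $C_0$-semigroup $(\mathcal{V}(t))_{t\ge0}$ whose generator $\mathcal{G}$ extends $(\mathcal{A}+\mathcal{B},\mathscr{D}(\mathcal{A}))$; it satisfies $(\lambda-\mathcal{G})^{-1}u=\lim_{n\to\infty}(\lambda-\mathcal{A})^{-1}\sum_{k=0}^n[\mathcal{B}(\lambda-\mathcal{A})^{-1}]^ku$ for all $\lambda>0$, $u\in\mathfrak{X}$. Functionals: $\mathfrak{a}_0(u)=-\langle\mathbf{\Psi},\mathcal{G}u\rangle$ for $u\in\mathscr{D}(\mathcal{G})$; $\mathfrak{a}$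 is its restriction to $\mathscr{D}(\mathcal{A})$; and $\overline{\mathfrak{a}}:\mathscr{D}(\mathcal{G})\to\mathbb{R}$ is the linear functional defined by $\overline{\mathfrak{a}}((\lambda-\mathcal{G})^{-1}u)=\sum_{n=0}^\infty\mathfrak{a}\big((\lambda-\mathcal{A})^{-1}[\mathcal{B}(\lambda-\mathcal{A})^{-1}]^nu\big)$, $u\in\mathfrak{X}$, where the series converges and the resulting functional does not depend on $\lambda>0$. For $\lambda>0$, $\mathbf{\Xi}_\lambda\in\mathfrak{X}^\star$ is defined by $\langle\mathbf{\Xi}_\lambda,u\rangle=\mathfrak{a}_0((\lambda-\mathcal{G})^{-1}u)-\overline{\mathfrak{a}}((\lambda-\mathcal{G})^{-1}u)$, $u\in\mathfrak{X}$. *)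

(* Defs.v *)
From HB Require Import structures.
From mathcomp Require Import all_boot all_order all_algebra.
From mathcomp Require Import all_classical all_reals all_analysis.

Set Implicit Arguments.
Unset Strict Implicit.
Unset Printing Implicit Defensive.

Import Order.TTheory GRing.Theory Num.Theory.
Import numFieldNormedType.Exports.

Local Open Scope classical_set_scope.
Local Open Scope ring_scope.

(* A charge is a total function on [set T] whose values on non-measurable sets
   are meaningless; forcing them to be 0 makes Leibniz equality of signed
   measures the same as equality on the sigma-algebra. *)
Record signed_measure d (T : measurableType d) (R : realType) := SignedMeasure {
  charge_of :> {charge set T -> \bar R} ;
  charge_of_out : forall A : set T, ~ measurable A -> charge_of A = 0%E
}.

Section signed_measure_space.
Context d (T : measurableType d) (R : realType).
Implicit Types (mu nu : signed_measure T R) (c : {charge set T -> \bar R}).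

Lemma charge_inj c1 c2 : (c1 : set T -> \bar R) = c2 -> c1 = c2.
Proof.
case: c1 => f [[a1] [b1] [e1]]; case: c2 => g [[a2] [b2] [e2]] /= fg.
move: a1 b1 e1 a2 b2 e2; rewrite {}fg => a1 b1 e1 a2 b2 e2.
by rewrite (Prop_irrelevance a1 a2) (Prop_irrelevance b1 b2)
  (Prop_irrelevance e1 e2).
Qed.

Lemma signed_measure_ext mu nu :
  (forall A, measurable A -> mu A = nu A) -> mu = nu.
Proof.
move=> munu; have : charge_of mu = charge_of nu.
  apply: charge_inj; apply/funext => A.
  have [/munu//|nA] := pselect (measurable A).
  by rewrite !charge_of_out.
case: mu nu {munu} => [m1 h1] [m2 h2] /= m12; move: h1 h2; rewrite {}m12.
by move=> h1 h2; rewrite (Prop_irrelevance h1 h2).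
Qed.

Lemma sm_finE mu A : measurable A -> (fine (mu A))%:E = mu A.
Proof. by move=> mA; rewrite fineK// fin_num_measure. Qed.

Let zero_out (A : set T) : ~ measurable A -> (czero : set T -> \bar R) A = 0%E.
Proof. by []. Qed.
Definition sm_zero : signed_measure T R := SignedMeasure zero_out.

Let add_out mu nu (A : set T) : ~ measurable A -> cadd mu nu A = 0%E.
Proof. by move=> nA; rewrite /cadd /= !charge_of_out// adde0. Qed.
Definition sm_add mu nu : signed_measure T R := SignedMeasure (@add_out mu nu).

Let scale_out (a : R) mu (A : set T) : ~ measurable A -> cscale a mu A = 0%E.
Proof. by move=> nA; rewrite /cscale /= !charge_of_out// mule0. Qed.
Definition sm_scale (a : R) mu : signed_measure T R :=
  SignedMeasure (@scale_out a mu).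

Definition sm_opp mu := sm_scale (-1) mu.

Lemma sm_addE mu nu A : sm_add mu nu A = (mu A + nu A)%E.
Proof. by []. Qed.

Lemma sm_scaleE a mu A : sm_scale a mu A = (a%:E * mu A)%E.
Proof. by []. Qed.

HB.instance Definition _ := gen_eqMixin (signed_measure T R).
HB.instance Definition _ := gen_choiceMixin (signed_measure T R).

Let sm_addA : associative sm_add.
Proof.
by move=> m1 m2 m3; apply: signed_measure_ext => A mA; rewrite !sm_addE addeA.
Qed.

Let sm_addC : commutative sm_add.
Proof.
by move=> m1 m2; apply: signed_measure_ext => A mA; rewrite !sm_addE addeC.
Qed.

Let sm_add0 : left_id sm_zero sm_add.
Proof.
by move=> m; apply: signed_measure_ext => A mA; rewrite sm_addE add0e.
Qed.

Let sm_addN : left_inverse sm_zero sm_opp sm_add.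
Proof.
move=> m; apply: signed_measure_ext => A mA.
by rewrite sm_addE sm_scaleE -sm_finE// -EFinM -EFinD mulN1r addNr.
Qed.

HB.instance Definition _ := GRing.isZmodule.Build (signed_measure T R)
  sm_addA sm_addC sm_add0 sm_addN.

Let sm_scaleA a b mu : sm_scale a (sm_scale b mu) = sm_scale (a * b) mu.
Proof.
apply: signed_measure_ext => A mA.
by rewrite !sm_scaleE -(sm_finE mu mA) -!EFinM mulrA.
Qed.

Let sm_scale1 : left_id 1 sm_scale.
Proof.
by move=> mu; apply: signed_measure_ext => A mA; rewrite sm_scaleE mul1e.
Qed.

Let sm_scaleDr : right_distributive sm_scale +%R.
Proof.
move=> a m1 m2; apply: signed_measure_ext => A mA.
rewrite [RHS]sm_addE !sm_scaleE [(m1 + m2)%R A]sm_addE.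
by rewrite -(sm_finE m1 mA) -(sm_finE m2 mA) -EFinD -!EFinM -EFinD mulrDr.
Qed.

Let sm_scaleDl mu : {morph sm_scale^~ mu : a b / a + b}.
Proof.
move=> a b; apply: signed_measure_ext => A mA.
rewrite [RHS]sm_addE !sm_scaleE -(sm_finE mu mA).
by rewrite -!EFinM -!EFinD mulrDl.
Qed.

HB.instance Definition _ := GRing.Zmodule_isLmodule.Build R (signed_measure T R)
  sm_scaleA sm_scale1 sm_scaleDr sm_scaleDl.

Lemma signed_measureD mu nu A : (mu + nu) A = (mu A + nu A)%E.
Proof. by []. Qed.

Lemma signed_measureZ a mu A : (a *: mu) A = (a%:E * mu A)%E.
Proof. by []. Qed.

Definition hahn_pos mu : set T := projT1 (cid (Hahn_decomposition mu)).

Definition hahn_neg mu : set T :=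
  projT1 (cid (projT2 (cid (Hahn_decomposition mu)))).

Lemma hahnP mu : hahn_decomposition mu (hahn_pos mu) (hahn_neg mu).
Proof. exact: (projT2 (cid (projT2 (cid (Hahn_decomposition mu))))). Qed.

Definition variation mu : {measure set T -> \bar R} :=
  charge_variation (hahnP mu).

Definition tv_norm mu : R := fine (variation mu [set: T]).

Lemma variation_fin mu A : measurable A -> variation mu A \is a fin_num.
Proof. by move=> mA; rewrite /variation /= fin_num_measure. Qed.

Lemma tv_normE mu :
  tv_norm mu = fine (mu (hahn_pos mu)) - fine (mu (hahn_neg mu)).
Proof.
have [[mP _] [mN _] _ _] := hahnP mu.
apply: EFin_inj; rewrite /tv_norm fineK ?variation_fin// EFinB !sm_finE//.
rewrite /variation /= /charge_variation jordan_posE cjordan_posE.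
rewrite jordan_negE cjordan_negE /crestr0 !mem_set// /crestr/=.
by rewrite !setTI.
Qed.

Lemma tv_norm_ge mu (P N : set T) : measurable P -> measurable N ->
  P `&` N = set0 -> fine (mu P) - fine (mu N) <= tv_norm mu.
Proof.
move=> mP mN PN0; rewrite -lee_fin /tv_norm fineK ?variation_fin//.
rewrite EFinB !sm_finE//.
apply: (@le_trans _ _ (variation mu (P `|` N))); last first.
  by rewrite le_measure// inE//; exact: measurableU.
rewrite measureU//; apply: leeD.
  exact: le_trans (lee_abs _) (abse_charge_variation (hahnP mu) mP).
apply: le_trans (abse_charge_variation (hahnP mu) mN).
by rewrite -abseN lee_abs.
Qed.

Let tv_normD mu nu : tv_norm (mu + nu) <= tv_norm mu + tv_norm nu.
Proof.
have [[mP _] [mN _] _ PN0] := hahnP (mu + nu).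
rewrite [leLHS]tv_normE !signed_measureD !fineD ?fin_num_measure//.
by rewrite opprD addrACA lerD// tv_norm_ge.
Qed.

Let tv_normZ_le a mu : tv_norm (a *: mu) <= `|a| * tv_norm mu.
Proof.
have [[mP _] [mN _] _ PN0] := hahnP (a *: mu).
rewrite [leLHS]tv_normE !signed_measureZ !fineM ?fin_num_measure// -mulrBr.
have [a0|a0] := leP 0 a.
  by rewrite ger0_norm// ler_wpM2l// tv_norm_ge.
rewrite ltr0_norm// -[leLHS]mulrNN opprB ler_wpM2l ?oppr_ge0 ?(ltW a0)//.
by rewrite tv_norm_ge// setIC.
Qed.

Let tv_norm_ge0 mu : 0 <= tv_norm mu.
Proof. exact: fine_ge0. Qed.

Let tv_normZ a mu : tv_norm (a *: mu) = `|a| * tv_norm mu.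
Proof.
apply/eqP; rewrite eq_le tv_normZ_le/=.
have [->|a0] := eqVneq a 0; first by rewrite normr0 mul0r tv_norm_ge0.
rewrite -ler_pdivlMl ?normr_gt0//.
rewrite -{1}(scale1r mu) -(mulVf a0) -scalerA -normfV.
exact: tv_normZ_le.
Qed.

Let tv_norm0 mu : tv_norm mu = 0 -> mu = 0.
Proof.
move=> mu0; apply: signed_measure_ext => A mA.
rewrite -[LHS]sm_finE//; congr EFin; apply/eqP; rewrite eq_le.
have := @tv_norm_ge mu A set0 mA measurable0 (setI0 _).
have := @tv_norm_ge mu set0 A measurable0 mA (set0I _).
by rewrite !charge0 /= sub0r subr0 mu0 oppr_le0 => -> ->.
Qed.

HB.instance Definition _ := Lmodule_isNormed.Build R (signed_measure T R)
  tv_normD tv_normZ tv_norm0.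

Lemma signed_measure_normE mu : `|mu| = tv_norm mu.
Proof. by []. Qed.

Definition pos_cone : set (signed_measure T R) :=
  [set mu | forall A, measurable A -> (0 <= mu A)%E].

Definition Psi mu : R := fine (mu [set: T]).

Definition abs_cont nu mu := nu `<< variation mu.

Definition linear_subspace (S : set (signed_measure T R)) :=
  S 0 /\ forall (a : R) mu nu, S mu -> S nu -> S (a *: mu + nu).

Definition closed_subspace (S : set (signed_measure T R)) :=
  linear_subspace S /\ closed S.

Definition M_ideal (S : set (signed_measure T R)) :=
  closed_subspace S /\
  forall mu nu, S mu -> abs_cont nu mu -> S nu.

Definition disjoint_complement (S : set (signed_measure T R)) :
    set (signed_measure T R) :=
  [set mu | forall nu, abs_cont nu mu -> S nu -> nu = 0].

(* Direct sum in the sense of Banach spaces: both summands are closed. *)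
Definition is_direct_sum (S1 S2 : set (signed_measure T R)) :=
  [/\ closed_subspace S1, closed_subspace S2,
      [set mu + nu | mu in S1 & nu in S2] = setT &
      S1 `&` S2 = [set 0]].

End signed_measure_space.

Section semigroups.
Context d (T : measurableType d) (R : realType).
Local Notation X := (signed_measure T R).
Implicit Types (S V W : R -> {linear X -> X}) (u w : X).

(* Semigroups are indexed by [R]; only times [0 <= t] matter. *)
Definition C0_semigroup S :=
  [/\ forall t, 0 <= t -> continuous (S t),
      forall u, S 0 u = u,
      forall s t u, 0 <= s -> 0 <= t -> S (s + t) u = S s (S t u) &
      forall u, S t u @[t --> 0^'+] --> u].

Definition substochastic S :=
  [/\ C0_semigroup S,
      forall t u, 0 <= t -> pos_cone u -> pos_cone (S t u) &
      forall t u, 0 <= t -> pos_cone u -> `|S t u| <= `|u|].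

(* An operator with a domain; the values of [op_fun] outside [op_dom] are
   irrelevant. *)
Record operator := Operator { op_dom : set X ; op_fun :> X -> X }.

Definition generator S : operator :=
  let quot u := fun h : R => h^-1 *: (S h u - u) in
  {| op_dom := [set u | cvg (quot u h @[h --> 0^'+])] ;
     op_fun := fun u => lim (quot u h @[h --> 0^'+]) |}.

Definition linear_on (D : set X) (B : X -> X) :=
  forall (a : R) u w, D u -> D w -> B (a *: u + w) = a *: B u + B w.

Definition positive_on (D : set X) (B : X -> X) :=
  forall u, D u -> pos_cone u -> pos_cone (B u).

Definition extends (G A : operator) :=
  op_dom A `<=` op_dom G /\ forall u, op_dom A u -> G u = A u.

(* The operator A + B, with domain that of A. *)
Definition perturb (A : operator) (B : X -> X) : operator :=
  {| op_dom := op_dom A ; op_fun := fun u => A u + B u |}.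

Definition minimal_semigroup (A : operator) (B : X -> X) V :=
  [/\ substochastic V,
      extends (generator V) (perturb A B) &
      forall W, substochastic W -> extends (generator W) (perturb A B) ->
        forall t u, 0 <= t -> pos_cone u ->
          pos_cone (W t u - V t u)].

(* (lambda - A)^-1 u; meaningful when lambda - A is a bijection from the domain
   of A onto X, as for lambda > 0 and A the generator of a substochastic
   semigroup. *)
Definition resolvent (A : operator) (lambda : R) (u : X) : X :=
  get [set w | op_dom A w /\ lambda *: w - A w = u].

Section functionals.
Variables (A : operator) (B : X -> X) (G : operator).
Local Notation RA lambda := (resolvent A lambda).
Local Notation RG lambda := (resolvent G lambda).

Definition functional_a0 (w : X) : R := - Psi (G w).

(* The number r such that, whenever w = (lambda - G)^-1 u with lambda > 0,
   r is the sum of the series of the a((lambda - A)^-1 [B (lambda - A)^-1]^n u);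
   the arguments lie in the domain of A, where the functional a is
   [functional_a0]. *)
Definition functional_abar (w : X) : R :=
  get [set r : R | forall (lambda : R) (u : X), 0 < lambda ->
    w = RG lambda u ->
    series (fun n => functional_a0
      (RA lambda (iter n (fun v => B (RA lambda v)) u))) @ \oo --> r].

Definition Xi (lambda : R) (u : X) : R :=
  functional_a0 (RG lambda u) - functional_abar (RG lambda u).

Definition H_cone : set X :=
  [set u | pos_cone u /\ forall lambda, 0 < lambda -> Xi lambda u = 0].

Definition H_space : set X := [set u - w | u in H_cone & w in H_cone].

End functionals.
End semigroups.

(* Main.v *)
(* Write [K := B (lambda - A)^-1].  The Kato series
   [S_lambda := sum_n (lambda - A)^-1 K^n] converges because the norm is
   additive on the positive cone, satisfies the resolvent equation, and is
   therefore (Hille-Yosida) the resolvent of a substochastic semigroup whose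
   generator extends [A + B].  Minimality of [V] gives
   [(lambda - G)^-1 <= S_lambda]; the converse inequality holds for every
   substochastic semigroup whose generator extends [A + B], since
   [(lambda - G)^-1 u] exceeds the [N]-th partial sum at [u >= 0] by
   [(lambda - G)^-1 K^N u].  Hence [(lambda - G)^-1 = S_lambda], the functional
   [abar] is independent of [lambda], and [Xi_lambda u = lim <Psi, K^N u>] is a
   positive linear functional dominated by [Psi].  So the cone [H_cone] is a
   closed face of the positive cone, and such a face spans a band: with Hahn
   decompositions of [n |mu| - |nu|] one sees that the span is stable under
   absolute continuity, and an exhaustion argument splits every measure into
   a part in the span and a part singular to it. *)

Require Import Defs.
From HB Require Import structures.
From mathcomp Require Import all_boot all_order all_algebra.
From mathcomp Require Import ring lra zify.
From mathcomp Require Import all_classical all_reals all_analysis.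

Set Implicit Arguments.
Unset Strict Implicit.
Unset Printing Implicit Defensive.

Import Order.TTheory GRing.Theory Num.Theory.
Import numFieldNormedType.Exports.

Local Open Scope classical_set_scope.
Local Open Scope ring_scope.

(** * Linear expressions *)

Section linear_expressions.
Context {R : comNzRingType} {E : lmodType R}.

(** The iterates $K^N u$ need not tend to 0: the mass they keep is exactly what [Xi] measures.
    Identities that involve two parameters $l, m$ are therefore obtained by applying $S_m$, or the
    functional [kato_alpha m], to the exact equation of a partial sum; the remainder vanishes only
    after that application. It mixes iterates for $l$ with an operator for $m$, and is dominated by
    an unmixed tail because positive resolvents decrease in the parameter.

    No vector-valued integral is formed. The resolvent of a semigroup is the limit of the resolvents
    of its difference quotients, which are geometric series with nonnegative coefficients, so an
    order relation between two semigroups passes to their resolvents term by term. Conversely, a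
    resolvent family yields its semigroup through the implicit Euler scheme, whose steps are
    positive multiples of resolvents; hence closed cones invariant under the resolvents stay
    invariant. Both constructions use dyadic steps, so that a finer step always divides a coarser
    one. *)

Inductive lexp :=
  LZero | LVar of nat | LAdd of lexp & lexp | LOpp of lexp | LScale of R & lexp.

Fixpoint leval (s : seq E) (e : lexp) : E :=
  match e with
  | LZero => 0
  | LVar n => nth 0 s n
  | LAdd a b => leval s a + leval s b
  | LOpp a => - leval s a
  | LScale c a => c *: leval s a
  end.

(** The comparison [eqn] computes on numerals, so simplification turns each coefficient into a plain
    ring expression. *)
Fixpoint lcoef (i : nat) (e : lexp) : R :=
  match e with
  | LZero => 0
  | LVar n => if eqn n i then 1 else 0
  | LAdd a b => lcoef i a + lcoef i b
  | LOpp a => - lcoef i a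
  | LScale c a => c * lcoef i a
  end.

Fixpoint lcoef_eq (n : nat) (a b : lexp) : Prop :=
  if n is m.+1 then lcoef m a = lcoef m b /\ lcoef_eq m a b else True.

Lemma leval_coef s e : leval s e = \sum_(i < size s) lcoef i e *: s`_i.
Proof.
elim: e => [|n|a IHa b IHb|a IHa|c a IHa] /=.
- by rewrite big1// => i _; rewrite scale0r.
- have [sn|ns] := leqP (size s) n.
    rewrite nth_default// big1// => i _; rewrite -[eqn _ _]/(n == i :> nat).
    by rewrite gtn_eqF ?scale0r// (leq_trans _ sn).
  rewrite (bigD1 (Ordinal ns))//= -[eqn _ _]/(n == n) eqxx scale1r.
  rewrite big1 ?addr0// => i; rewrite -val_eqE /= eq_sym -[eqn _ _]/(n == i :> nat).
  by move=> /negPf ->; rewrite scale0r.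
- by rewrite {}IHa {}IHb -big_split; apply: eq_bigr => i _ /=; rewrite scalerDl.
- by rewrite {}IHa -sumrN; apply: eq_bigr => i _; rewrite scaleNr.
- by rewrite {}IHa scaler_sumr; apply: eq_bigr => i _; rewrite scalerA.
Qed.

Lemma leval_eq s a b : lcoef_eq (size s) a b -> leval s a = leval s b.
Proof.
move=> ab; rewrite !leval_coef; apply: eq_bigr => -[i /= si] _.
suff -> : lcoef i a = lcoef i b by [].
elim: (size s) ab si => //= n IH [nab /IH nIH].
by rewrite ltnS leq_eqVlt => /predU1P[->//|/nIH].
Qed.

End linear_expressions.

(** The match on [goal] runs [unify] while a term is being built; when it fails, the next atom is
    tried. *)
Ltac lexp_index x s :=
  match s with
  | @cons _ ?y _ => let _ := match goal with _ => unify x y end in constr:(O)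
  | @cons _ _ ?t => let n := lexp_index x t in constr:(S n)
  end.
Ltac lexp_atoms E e s :=
  lazymatch e with
  | (?a + ?b)%R => let s' := lexp_atoms E a s in lexp_atoms E b s'
  | (- ?a)%R => lexp_atoms E a s
  | (_ *: ?a)%R => lexp_atoms E a s
  | 0%R => s
  | _ => match goal with
    | _ => let _ := lexp_index e s in s
    | _ => constr:(@cons E e s)
    end
  end.
Ltac lexp_quote R e s :=
  lazymatch e with
  | (?a + ?b)%R =>
      let a' := lexp_quote R a s in let b' := lexp_quote R b s in
      constr:(@LAdd R a' b')
  | (- ?a)%R => let a' := lexp_quote R a s in constr:(@LOpp R a')
  | (?c *: ?a)%R => let a' := lexp_quote R a s in constr:(@LScale R c a')
  | 0%R => constr:(@LZero R)
  | _ => let n := lexp_index e s in constr:(@LVar R n)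
  end.

(* Decides an equality in a module over [R] by comparing the coefficients of
   the atoms with [ring]; the comparisons that [ring] does not settle are left
   as subgoals. *)
Ltac module_eq R :=
  match goal with
  | |- @eq ?E ?l ?r =>
      let s0 := lexp_atoms E l (@nil E) in
      let s := lexp_atoms E r s0 in
      let l' := lexp_quote R l s in
      let r' := lexp_quote R r s in
      change (leval s l' = leval s r');
      apply: leval_eq; rewrite /=; do ?split; try ring
  end.

(** * Contraction semigroups and their resolvents *)

Section limits_in_normed_modules.
Context {R : realType}.

Section normed_module.
Context {E : normedModType R}.
Implicit Types (u : nat -> E) (l x : E).

Lemma cvgn_normP u l : u @ \oo --> l <->
  forall e, 0 < e -> exists N, forall n, (N <= n)%N -> `|l - u n| <= e.
Proof.
split=> [/cvgrPdist_le ul e /ul[N _ NP]|ul].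
  by exists N => n Nn; exact: NP.
by apply/cvgrPdist_le => e /ul[N NP]; exists N.
Qed.

Lemma cvg_right0P (f : R -> E) l : f h @[h --> 0^'+] --> l <->
  forall e, 0 < e -> exists2 d, 0 < d &
    forall h, 0 < h -> h <= d -> `|l - f h| <= e.
Proof.
split=> [/cvgrPdist_le fl e /fl [d /= d0 dP]|fl].
  exists (d / 2) => [|h h0 hd]; first lra.
  by apply: dP => //=; rewrite sub0r normrN gtr0_norm//; lra.
apply/cvgrPdist_le => e /fl[d d0 dP]; near=> h; apply: dP.
  by near: h; exact: nbhs_right_gt.
by near: h; exact: nbhs_right_le.
Unshelve. all: by end_near. Qed.

Lemma norm_cvgn_le u l (c : R) N : u @ \oo --> l ->
  (forall n, (N <= n)%N -> `|u n| <= c) -> `|l| <= c.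
Proof.
move=> ul uc; apply/ler_addgt0Pr => e e0.
have [M MP] := (cvgn_normP u l).1 ul e e0; set n := maxn M N.
rewrite -(subrK (u n) l) addrC (le_trans (ler_normD _ _))// lerD//.
  by rewrite uc// leq_maxr.
by rewrite MP// leq_maxl.
Qed.

Lemma cvgn_in_closed (P : set E) u l : closed P -> u @ \oo --> l ->
  (forall n, P (u n)) -> P l.
Proof.
by move=> cP ul Pu; apply: (closed_cvg P cP _ _ ul); apply: nearW.
Qed.

Lemma cvgn_eq u l l' : u @ \oo --> l -> u @ \oo --> l' -> l = l'.
Proof. exact: (cvg_unique (@norm_hausdorff R E)). Qed.

Lemma cvg_contraction (f : {linear E -> E}) u l :
  (forall x, `|f x| <= `|x|) -> u @ \oo --> l -> f (u n) @[n --> \oo] --> f l.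
Proof.
move=> f1 ul; apply/cvgn_normP => e e0.
have [N NP] := (cvgn_normP u l).1 ul e e0; exists N => n Nn.
by rewrite -linearB (le_trans (f1 _))// NP.
Qed.

Lemma contraction_continuous (f : {linear E -> E}) :
  (forall x, `|f x| <= `|x|) -> continuous f.
Proof.
move=> f1 x; apply/cvgrPdist_le => e e0.
have : \forall y \near x, `|x - y| <= e 
  by move: e e0; apply/(@cvgrPdist_le _ _ _ (nbhs x) _ id x); exact: cvg_id.
by apply: filterS => y; rewrite -linearB; exact: le_trans.
Qed.

End normed_module.

Lemma cauchyn_cvg {E : completeNormedModType R} (u : nat -> E) :
  (forall e, 0 < e -> exists N, forall n, (N <= n)%N -> `|u N - u n| <= e) ->
  cvgn u.
Proof.
move=> uC; apply/cauchy_cvgP/cauchy_exP => e e0.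
have [|N NP] := uC (e / 2); first lra.
exists (u N); exists N => // n Nn; rewrite /= -ball_normE /=.
by rewrite (le_lt_trans (NP _ Nn))//; lra.
Qed.

Lemma dyadic_gt0 n : 0 < (2 ^- n : R).
Proof. by rewrite invr_gt0 exprn_gt0. Qed.

Lemma dyadicS n : 2 ^- n = 2 * 2 ^- n.+1 :> R.
Proof. by rewrite exprS; field; rewrite lt0r_neq0// exprn_gt0. Qed.


Lemma dyadic_small (e : R) : 0 < e ->
  exists N, forall n, (N <= n)%N -> 2 ^- n <= e.
Proof.
move=> e0; have [N _ NP] := near_infty_natSinv_expn_lt (PosNum e0).
by exists N => n /NP /=; rewrite div1r => /ltW.
Qed.

(** The number of whole steps of length [2 ^- n] that fit into a time [t >= 0], not the rounded time
    itself. *)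
Definition dyadic_floor (t : R) n : nat := Num.trunc (t * 2 ^+ n).

Lemma dyadic_floor_le t n : 0 <= t -> (dyadic_floor t n)%:R * 2 ^- n <= t.
Proof.
move=> t0; rewrite ler_pdivrMr ?exprn_gt0// truncn_le.
by rewrite mulr_ge0// exprn_ge0.
Qed.

Lemma dyadic_floor_gt t n : 0 <= t ->
  t - (dyadic_floor t n)%:R * 2 ^- n <= 2 ^- n.
Proof.
move=> t0; rewrite lerBlDr -[leRHS]/(_ + _) -{1}[2 ^- n]mul1r -mulrDl nat1r ler_pdivlMr ?exprn_gt0//.
by have /andP[_ /ltW] := truncn_itv (mulr_ge0 t0 (exprn_ge0 n (ler0n R 2))).
Qed.

End limits_in_normed_modules.

Section contraction_semigroups.
Context {R : realType} {E : completeNormedModType R}.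
Implicit Types (S : R -> {linear E -> E}).

Definition contraction_semigroup S :=
  [/\ forall u, S 0 u = u,
      forall s t u, 0 <= s -> 0 <= t -> S (s + t) u = S s (S t u),
      forall t u, 0 <= t -> `|S t u| <= `|u| &
      forall u, S t u @[t --> 0^'+] --> u].

(** The graph of the generator. As a relation it carries membership in the domain and the value
    together. *)
Definition generates S (x g : E) :=
  h^-1 *: (S h x - x) @[h --> 0^'+] --> g.

Lemma generatesP S x g :
  (forall e, 0 < e -> exists2 d, 0 < d &
    forall t, 0 < t -> t <= d -> `|S t x - x - t *: g| <= e * t) <->
  generates S x g.
Proof.
have eqn t : 0 < t -> `|g - t^-1 *: (S t x - x)| = `|S t x - x - t *: g| / t.
  move=> t0; have -> : g - t^-1 *: (S t x - x) = - (t^-1 *: (S t x - x - t *: g)).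
    by module_eq R; field; lra.
  by rewrite normrN normrZ gtr0_norm ?invr_gt0// mulrC.
split=> [H|/cvg_right0P H].
  apply/cvg_right0P => e /H[d d0 dP]; exists d => // t t0 td.
  by rewrite eqn// ler_pdivrMr// dP.
move=> e /H[d d0 dP]; exists d => // t t0 td.
by rewrite -ler_pdivrMr// -eqn// dP.
Qed.

Lemma generates_linear S c x y g k :
  generates S x g -> generates S y k -> generates S (c *: x + y) (c *: g + k).
Proof.
move=> xg yk; rewrite /generates.
have -> : (fun h => h^-1 *: (S h (c *: x + y) - (c *: x + y))) =
    (fun h => c *: (h^-1 *: (S h x - x)) + h^-1 *: (S h y - y)).
  by apply/funext => h; rewrite (linearP (S h)); module_eq R.
by apply: cvgD => //; apply: cvgZr.
Qed.
Arguments generates_linear {S} c {x y g k}.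

(** * The resolvent as a limit of Riemann sums *)

Section resolvent_of_a_semigroup.
Variables (S : R -> {linear E -> E}) (l : R).
Hypotheses (semiS : contraction_semigroup S) (l0 : 0 < l).

Let S0 u : S 0 u = u. Proof. by have [] := semiS. Qed.
Let SD s t u : 0 <= s -> 0 <= t -> S (s + t) u = S s (S t u).
Proof. by have [_ + _ _] := semiS; exact. Qed.
Let S1 t u : 0 <= t -> `|S t u| <= `|u|.
Proof. by have [_ _ + _] := semiS; exact. Qed.

Lemma semigroup_modulus u e : 0 < e -> exists2 d, 0 < d &
  forall s, 0 <= s -> s <= d -> `|S s u - u| <= e.
Proof.
move=> e0; have [_ _ _ /(_ u)/cvg_right0P/(_ e e0)[d d0 dP]] := semiS.
exists d => // s; rewrite le_eqVlt => /predU1P[<- _|s0 sd].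
  by rewrite S0 subrr normr0 ltW.
by rewrite distrC dP.
Qed.

Let Spow h m x : 0 <= h ->
  S (m%:R * h) x - x = \sum_(i < m) S (i%:R * h) (S h x - x).
Proof.
move=> h0; elim: m => [|m IH]; first by rewrite mul0r S0 subrr big_ord0.
rewrite big_ord_recr /= -IH linearB -SD ?mulr_ge0//.
have -> : m%:R * h + h = m.+1%:R * h by rewrite -natr1; ring.
by module_eq R.
Qed.

(* The resolvent of the bounded operator [h^-1 (S h - 1)]: a Riemann sum of the
   Laplace transform of the semigroup. *)
Definition euler_term h f (k : nat) : E :=
  (h * (1 + l * h)^-1 ^+ k.+1) *: S (k%:R * h) f.
Definition euler_resolvent h f : E := limn (series (euler_term h f)).

(** This is [h] times $l - A_h$, where $A_h = h^{-1}(S_h - 1)$ is the difference quotient.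
    Contractivity of [S h] bounds it below by [l * h], which is the dissipativity behind all later
    estimates. *)
Let D h (x : E) : E := (1 + l * h) *: x - S h x.

Let D_ge h x : 0 < h -> l * h * `|x| <= `|D h x|.
Proof.
move=> h0; have lh : 0 < l * h by rewrite mulr_gt0.
have := lerB_dist ((1 + l * h) *: x) (S h x).
by rewrite normrZ gtr0_norm; [have := S1 x (ltW h0); rewrite /D; lra|lra].
Qed.

Lemma euler_resolvent_cvg h f : 0 < h ->
  series (euler_term h f) @ \oo --> euler_resolvent h f.
Proof.
move=> h0; have lh : 0 < l * h by rewrite mulr_gt0.
set r := (1 + l * h)^-1; have r0 : 0 < r by rewrite invr_gt0; lra.
have r1 : r < 1 by rewrite invf_lt1; lra.
apply: normed_cvg; rewrite /=.
apply: (@series_le_cvg _ _ (geometric (h * r * `|f|) r)) => [n|n|n|].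
- exact: normr_ge0.
- by rewrite /geometric /= !mulr_ge0 ?exprn_ge0// ltW.
- rewrite /= /euler_term normrZ ger0_norm; last first.
    by rewrite mulr_ge0 ?exprn_ge0// ltW.
  rewrite -/r exprS [leRHS](_ : _ = h * (r * r ^+ n) * `|f|); last by ring.
  by rewrite ler_wpM2l ?S1 ?mulr_ge0 ?exprn_ge0// ltW.
- by apply: is_cvg_geometric_series; rewrite gtr0_norm.
Qed.

Arguments euler_resolvent_cvg : clear implicits.

(** The partial sums satisfy $(1 + lh) s_{n+1} = h f + S_h s_n$; the equation is the limit of this
    recursion. *)
Lemma euler_resolventE h f : 0 < h ->
  D h (euler_resolvent h f) = h *: f.
Proof.
move=> h0; have lh : 0 < l * h by rewrite mulr_gt0.
have cvgx := euler_resolvent_cvg h f h0.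
set x := euler_resolvent h f in cvgx *.
have rec n : (1 + l * h) *: series (euler_term h f) n.+1 =
    h *: f + S h (series (euler_term h f) n).
  elim: n => [|n IH].
    rewrite !seriesEnat /= big_nat1 big_geq// linear0 addr0 /euler_term.
    by rewrite mul0r S0 scalerA; congr (_ *: _); field; lra.
  rewrite seriesSr scalerDr IH seriesSr linearD addrA; congr (_ + _).
  rewrite /euler_term [in RHS]linearZ /= -SD ?mulr_ge0// ?ltW//.
  rewrite (_ : n.+1%:R * h = h + n%:R * h); last by rewrite -natr1; ring.
  by rewrite scalerA; congr (_ *: _); rewrite [_ ^+ n.+2]exprS; field; lra.
have c1 : (1 + l * h) *: series (euler_term h f) n.+1 @[n --> \oo] -->
    (1 + l * h) *: x.
  by apply: cvgZr; rewrite (cvg_shiftS (series (euler_term h f))).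
have c2 : h *: f + S h (series (euler_term h f) n) @[n --> \oo] -->
    h *: f + S h x.
  apply: cvgD; first exact: cvg_cst.
  by apply: cvg_contraction => // u; rewrite S1// ltW.
have := cvgn_eq c1; rewrite (funext rec) => /(_ _ c2) xE.
by rewrite /D xE addrK.
Qed.

Let DS h s x : 0 < h -> 0 <= s -> D h (S s x) = S s (D h x).
Proof.
move=> h0 s0; rewrite /D (linearB (S s)) (linearZ_LR (S s)) -!SD// ?(ltW h0)//.
by rewrite [h + s]addrC.
Qed.

(** [D h] commutes with [S s], hence sends the difference on the left to [h] times [S s f - f]; the
    lower bound on [D h] concludes. The orbit of the resolvent thus moves no faster than that of
    [f], up to the factor [l]. *)
Let euler_comm h s f : 0 < h -> 0 <= s ->
  l * `|S s (euler_resolvent h f) - euler_resolvent h f| <= `|S s f - f|.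
Proof.
move=> h0 s0; rewrite -(ler_pM2l h0) mulrCA mulrA (le_trans (D_ge _ h0))//.
have -> : D h (S s (euler_resolvent h f) - euler_resolvent h f) =
    D h (S s (euler_resolvent h f)) - D h (euler_resolvent h f).
  by rewrite /D (linearB (S h)); module_eq R.
rewrite DS// euler_resolventE// linearZ -scalerBr normrZ gtr0_norm//.
Qed.

(** A discrete fundamental theorem of calculus: [l *: x - f] is the difference quotient $A_h x$,
    which is summed along the orbit. *)
Let euler_incr h m f : 0 < h ->
  let x := euler_resolvent h f in
  S (m%:R * h) x - x = h *: \sum_(i < m) S (i%:R * h) (l *: x - f).
Proof.
move=> h0 x; rewrite Spow ?(ltW h0)// scaler_sumr; apply: eq_bigr => i _.
rewrite -linearZ; congr (S _ _); have := euler_resolventE f h0.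
rewrite -/x /D => xE; have -> : S h x = (1 + l * h) *: x - h *: f.
  by rewrite -xE; module_eq R.
by module_eq R.
Qed.

(** Applied to the difference of the two resolvents, [D (m%:R * h)] leaves only the oscillation of
    [g] along the orbit up to time [m%:R * h]. Since [g] is [l *: y - f], its oscillation is that of
    [f] plus that of [l *: y], each at most [e]. *)
Let euler_refine h m f e : 0 < h -> (0 < m)%N ->
  (forall s, 0 <= s -> s <= m%:R * h -> `|S s f - f| <= e) ->
  l * `|euler_resolvent (m%:R * h) f - euler_resolvent h f| <= 2 * e.
Proof.
move=> h0 m0 fe; set H := m%:R * h.
have H0 : 0 < H by rewrite mulr_gt0// ltr0n.
set x := euler_resolvent H f; set y := euler_resolvent h f.
rewrite -(ler_pM2l H0) mulrCA mulrA (le_trans (D_ge _ H0))//.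
pose g := l *: y - f.
have -> : D H (x - y) = h *: \sum_(i < m) (S (i%:R * h) g - g).
  have xE : (1 + l * H) *: x - S H x = H *: f := euler_resolventE f H0.
  rewrite sumrB scalerBr -euler_incr// -/H -/y sumr_const card_ord.
  rewrite -scaler_nat /D (linearB (S H)).
  have -> : S H x = (1 + l * H) *: x - H *: f by rewrite -xE; module_eq R.
  by rewrite /g /H; module_eq R.
rewrite normrZ gtr0_norm// /H -mulrA mulrCA ler_pM2l//.
rewrite (le_trans (ler_norm_sum _ _ _))//.
have -> : m%:R * (2 * e) = \sum_(i < m) 2 * e.
  by rewrite sumr_const card_ord mulr_natl.
apply: ler_sum => i _.
have ih0 : 0 <= i%:R * h by rewrite mulr_ge0// ltW.
have ihH : i%:R * h <= m%:R * h by rewrite ler_pM2r// ler_nat ltnW.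
have -> : S (i%:R * h) g - g =
    l *: (S (i%:R * h) y - y) - (S (i%:R * h) f - f).
  by rewrite /g (linearB (S _)) (linearZ_LR (S _)); module_eq R.
rewrite (le_trans (ler_normB _ _))// normrZ gtr0_norm//.
have := euler_comm f h0 ih0; have := fe _ ih0 ihH; rewrite -/y; lra.
Qed.

(** Each step [2 ^- n] is an integral multiple of every later one, so [euler_refine] gives the
    Cauchy property. *)
Definition semigroup_resolvent f : E := limn (fun n => euler_resolvent (2 ^- n) f).

Lemma semigroup_resolvent_cvg f :
  euler_resolvent (2 ^- n) f @[n --> \oo] --> semigroup_resolvent f.
Proof.
apply: cauchyn_cvg => e e0.
have el : 0 < l * e / 2 by rewrite divr_gt0// mulr_gt0.
have [d d0 dP] := semigroup_modulus f el; have [N NP] := dyadic_small d0.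
exists N => n Nn; rewrite -(ler_pM2l l0) [leRHS](_ : _ = 2 * (l * e / 2)); last lra.
rewrite (_ : 2 ^- N = (2 ^ (n - N))%:R * 2 ^- n); last first.
  by rewrite natrX -[in 2 ^- n](subnK Nn) exprD; field; rewrite !expf_neq0.
apply: euler_refine; [exact: dyadic_gt0|by rewrite expn_gt0|].
move=> s s0 sN; apply: dP => //; rewrite (le_trans sN)// (le_trans _ (NP N _))//.
by rewrite natrX -[in 2 ^- n](subnK Nn) exprD invfM mulrA divff ?mul1r// expf_neq0.
Qed.


Arguments semigroup_resolvent_cvg : clear implicits.

(** [euler_incr] reaches only multiples of the step; this lets the rounded times be replaced by [t]
    in the limit. *)
Lemma semigroup_dyadic_cvg t (u : nat -> E) x : 0 <= t -> u @ \oo --> x ->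
  S ((dyadic_floor t n)%:R * 2 ^- n) (u n) @[n --> \oo] --> S t x.
Proof.
move=> t0 ux; apply/cvgn_normP => e e0; have e2 : 0 < e / 2 by lra.
have [d d0 dP] := semigroup_modulus x e2; have [N NP] := dyadic_small d0.
have [M MP] := (cvgn_normP u x).1 ux _ e2.
exists (maxn N M) => n; rewrite geq_max => /andP[Nn Mn].
set s := _ * _; have st : s <= t by exact: dyadic_floor_le.
have s0 : 0 <= s by rewrite mulr_ge0// ltW// dyadic_gt0.
have ts : t - s <= d by rewrite (le_trans (dyadic_floor_gt _ t0))// NP.
have -> : S t x - S s (u n) = S s ((S (t - s) x - x) + (x - u n)).
  rewrite linearD !(linearB (S s)) -SD ?subr_ge0// [s + _]addrC subrK.
  by module_eq R.
rewrite (le_trans (S1 _ s0))// (le_trans (ler_normD _ _))//.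
have := dP (t - s); rewrite subr_ge0 => /(_ st ts); have := MP n Mn; lra.
Qed.

(** The limit of [euler_incr] along rounded times. The bound [e * t] has to be uniform in the step;
    it comes from the modulus of continuity of the orbit of [g], together with two distances from
    [g] to its approximation [g_ n], each at most [e / 4]. *)
Lemma semigroup_resolvent_generates f :
  generates S (semigroup_resolvent f) (l *: semigroup_resolvent f - f).
Proof.
set x := semigroup_resolvent f; set g := _ - f; apply/generatesP => e e0.
have e4 : 0 < e / 4 by lra.
have [d d0 dP] := semigroup_modulus g e4; exists d => // t t0 td.
pose x_ n := euler_resolvent (2 ^- n) f; pose g_ n := l *: x_ n - f.
have xx : x_ @ \oo --> x by exact: semigroup_resolvent_cvg.
have gg : g_ @ \oo --> g.
  by apply: cvgB; [apply: cvgZr|exact: cvg_cst].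
pose t_ n : R := (dyadic_floor t n)%:R * 2 ^- n.
have tt : t_ @ \oo --> t.
  apply/cvgn_normP => e' e'0; have [N NP] := dyadic_small e'0.
  exists N => n Nn; rewrite /t_ ger0_norm; last first.
    by rewrite subr_ge0 dyadic_floor_le// ltW.
  by rewrite (le_trans (dyadic_floor_gt _ (ltW t0)))// NP.
have [N NP] := (cvgn_normP g_ g).1 gg _ e4.
apply: (@norm_cvgn_le _ _ (fun n => S (t_ n) (x_ n) - x_ n - t_ n *: g_ n) _ _ N).
  apply: cvgB; last exact: cvgZ.
  by apply: cvgB => //; apply: semigroup_dyadic_cvg => //; exact: ltW.
move=> n Nn; rewrite /t_; set m := dyadic_floor t n.
have h0 := dyadic_gt0 (R:=R) n; set h := 2 ^- n in h0 *.
rewrite euler_incr//.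
have -> : h *: (\sum_(i < m) S (i%:R * h) (l *: euler_resolvent h f - f))
    - (m%:R * h) *: g_ n = h *: \sum_(i < m) (S (i%:R * h) (g_ n) - g_ n).
  by rewrite sumrB sumr_const card_ord -[in RHS]scaler_nat /g_ /x_ -/h; module_eq R.
rewrite normrZ gtr0_norm//.
have mt : m%:R * h <= t by rewrite dyadic_floor_le// ltW.
rewrite (@le_trans _ _ (h * (m%:R * e)))//; last first.
  by rewrite mulrA mulrC [h * _]mulrC ler_pM2l.
rewrite ler_pM2l// (le_trans (ler_norm_sum _ _ _))//.
have -> : m%:R * e = \sum_(i < m) e by rewrite sumr_const card_ord mulr_natl.
apply: ler_sum => i _.
have i0 : 0 <= i%:R * h by rewrite mulr_ge0// ltW.
have it : i%:R * h <= d.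
  by rewrite (le_trans _ td)// (le_trans _ mt)// ler_pM2r// ler_nat ltnW.
have -> : S (i%:R * h) (g_ n) - g_ n =
    (S (i%:R * h) g - g) + (g - g_ n) - S (i%:R * h) (g - g_ n).
  by rewrite (linearB (S (i%:R * h)) g (g_ n)); module_eq R.
have := dP _ i0 it; have := NP n Nn; have := S1 (g - g_ n) i0.
move=> a b c; rewrite (le_trans (ler_normB _ _))//.
have := ler_normD (S (i%:R * h) g - g) (g - g_ n); lra.
Qed.

Arguments semigroup_resolvent_generates : clear implicits.

(** The lower bound on [D h], divided by [h] as [h] tends to 0. *)
Lemma generates_dissipative w g : generates S w g -> l * `|w| <= `|l *: w - g|.
Proof.
move=> /generatesP wg; apply/ler_addgt0Pr => e e0.
have [h h0 /(_ h h0 (lexx _)) hP] := wg e e0.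
rewrite -(ler_pM2l h0) mulrCA mulrA (le_trans (D_ge _ h0))//.
have -> : D h w = h *: (l *: w - g) - (S h w - w - h *: g).
  by rewrite /D; module_eq R.
rewrite (le_trans (ler_normB _ _))// normrZ gtr0_norm//; lra.
Qed.

Lemma generates_inj w w' g g' : generates S w g -> generates S w' g' ->
  l *: w - g = l *: w' - g' -> w = w'.
Proof.
move=> wg wg' e.
have := generates_linear (-1) wg' wg.
move=> /generates_dissipative.
have -> : l *: (-1 *: w' + w) - (-1 *: g' + g) = (l *: w - g) - (l *: w' - g').
  by module_eq R.
rewrite e subrr normr0 pmulr_rle0// normr_le0 scaleN1r addrC subr_eq0.
by move=> /eqP.
Qed.

Lemma semigroup_resolventK w g : generates S w g ->
  semigroup_resolvent (l *: w - g) = w.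
Proof.
move=> wg; apply: (generates_inj (semigroup_resolvent_generates _) wg).
by module_eq R.
Qed.

(* [z := l x - u], with [x] the Euler resolvent of [u], is compared with its
   average over the orbit up to time [2 ^- k]; the average is small because
   [D h z = S h u - u] telescopes. *)
Lemma semigroup_resolvent_near u k e :
  (forall s, 0 <= s -> s <= 2 ^- k -> `|S s u - u| <= e) ->
  `|l *: semigroup_resolvent u - u| <= 2 * e + 2 * `|u| / (l * 2 ^- k).
Proof.
move=> ue; have d0 := dyadic_gt0 (R := R) k; set d := 2 ^- k in ue d0 *.
have ld : 0 < l * d by rewrite mulr_gt0.
apply: (@norm_cvgn_le _ _ (fun n => l *: euler_resolvent (2 ^- n) u - u) _ _ k).
  by apply: cvgB; [apply: cvgZr; exact: semigroup_resolvent_cvg|exact: cvg_cst].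
move=> n kn; have h0 := dyadic_gt0 (R := R) n; set h := 2 ^- n in h0 *.
set x := euler_resolvent h u; set z := l *: x - u.
pose m := (2 ^ (n - k))%N; have mh : m%:R * h = d.
  by rewrite /d /h /m natrX -[in 2 ^- n](subnK kn) exprD invfM mulrA divff ?mul1r// expf_neq0.
have m0 : 0 < (m%:R : R) by rewrite ltr0n expn_gt0.
pose w := \sum_(i < m) S (i%:R * h) z.
have Dw : D h w = S d u - u.
  rewrite -mh Spow ?(ltW h0)//.
  have -> : S h u - u = D h z.
    have xE : (1 + l * h) *: x - S h x = h *: u := euler_resolventE u h0.
    have xE' : S h x = (1 + l * h) *: x - h *: u by rewrite -xE; module_eq R.
    by rewrite /D /z (linearB (S h)) (linearZ_LR (S h)) xE'; module_eq R.
  rewrite /D /w (linear_sum (S h)) scaler_sumr -sumrB; apply: eq_bigr => i _.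
  by rewrite -DS// mulr_ge0// ltW.
have wu : l * h * `|w| <= 2 * `|u|.
  rewrite (le_trans (D_ge _ h0))// Dw (le_trans (ler_normB _ _))//.
  by have := S1 u (ltW d0); lra.
have zw : `|m%:R *: z - w| <= m%:R * (2 * e).
  have -> : m%:R *: z - w = \sum_(i < m) (z - S (i%:R * h) z).
    by rewrite sumrB sumr_const card_ord scaler_nat.
  rewrite (le_trans (ler_norm_sum _ _ _))//.
  have -> : m%:R * (2 * e) = \sum_(i < m) 2 * e.
    by rewrite sumr_const card_ord mulr_natl.
  apply: ler_sum => i _.
  have i0 : 0 <= i%:R * h by rewrite mulr_ge0// ltW.
  have id : i%:R * h <= d by rewrite -mh ler_pM2r// ler_nat ltnW.
  have -> : z - S (i%:R * h) z =
      (S (i%:R * h) u - u) - l *: (S (i%:R * h) x - x).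
    by rewrite /z (linearB (S _)) (linearZ_LR (S _)); module_eq R.
  rewrite (le_trans (ler_normB _ _))// normrZ gtr0_norm//.
  by have := euler_comm u h0 i0; have := ue _ i0 id; rewrite -/x; lra.
rewrite -(ler_pM2l m0) mulrDr.
have -> : m%:R * `|z| = `|m%:R *: z| by rewrite normrZ gtr0_norm.
rewrite -(subrK w (m%:R *: z)) (le_trans (ler_normD _ _))// lerD//.
rewrite -mh mulrA ler_pdivlMr ?mulr_gt0//.
by rewrite [leLHS](_ : _ = m%:R * (l * h * `|w|)); [rewrite ler_pM2l|ring].
Qed.

(** Partial sums of the Euler series are combinations of points [S t f] with nonnegative
    coefficients, and two limits stay in a closed set. *)
Lemma semigroup_resolvent_closed (P : set E) f : closed P -> P 0 ->
  (forall x y, P x -> P y -> P (x + y)) -> (forall a x, 0 <= a -> P x -> P (a *: x)) ->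
  (forall t, 0 <= t -> P (S t f)) -> P (semigroup_resolvent f).
Proof.
move=> cP P0 PD PZ PS; apply: (cvgn_in_closed cP (semigroup_resolvent_cvg f)) => n.
apply: (cvgn_in_closed cP (euler_resolvent_cvg _ f (dyadic_gt0 n))) => N.
rewrite seriesEnat; apply: (big_ind P) => //= k _.
have h0 := ltW (dyadic_gt0 (R := R) n).
apply: PZ; last by apply: PS; rewrite mulr_ge0.
by rewrite mulr_ge0// exprn_ge0// invr_ge0 addr_ge0// mulr_ge0// ltW.
Qed.

End resolvent_of_a_semigroup.

Arguments euler_resolvent_cvg {S l}.
Arguments semigroup_resolvent_cvg {S l}.
Arguments semigroup_resolvent_generates {S l}.

Lemma semigroup_resolvent_strong_limit (S : R -> {linear E -> E}) u e :
  contraction_semigroup S -> 0 < e -> exists2 M, 0 < M &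
    forall l, M <= l -> `|l *: semigroup_resolvent S l u - u| <= e.
Proof.
move=> semiS e0; have e4 : 0 < e / 4 by lra.
have [d d0 dP] := semigroup_modulus semiS u e4; have [k kP] := dyadic_small d0.
have h0 := dyadic_gt0 (R := R) k; have u0 := normr_ge0 u.
(* This threshold makes [2 * |u| / (l * 2 ^- k)] at most [e / 2]; the summand 1 keeps it positive
   when [u] is 0. *)
have M0 : 0 < 4 * (`|u| + 1) / (e * 2 ^- k).
  by rewrite divr_gt0 ?mulr_gt0//; lra.
exists (4 * (`|u| + 1) / (e * 2 ^- k)) => // l Ml.
have l0 : 0 < l by lra.
rewrite (le_trans (@semigroup_resolvent_near _ _ semiS l0 u k (e / 4) _))//.
  by move=> s s0 sk; apply: dP => //; rewrite (le_trans sk)// kP.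
have : 2 * `|u| / (l * 2 ^- k) <= e / 2; last lra.
rewrite ler_pdivrMr ?mulr_gt0//; move: Ml.
rewrite ler_pdivrMr ?mulr_gt0//; nra.
Qed.

Lemma semigroup_resolvent_le (S S' : R -> {linear E -> E}) l (P : set E) f :
  contraction_semigroup S -> contraction_semigroup S' -> 0 < l ->
  closed P -> P 0 ->
  (forall x y, P x -> P y -> P (x + y)) -> (forall a x, 0 <= a -> P x -> P (a *: x)) ->
  (forall t, 0 <= t -> P (S' t f - S t f)) ->
  P (semigroup_resolvent S' l f - semigroup_resolvent S l f).
Proof.
move=> semiS semiS' l0 cP P0 PD PZ PS.
pose x n := euler_resolvent S' l (2 ^- n) f - euler_resolvent S l (2 ^- n) f.
apply: (@cvgn_in_closed _ _ P x) => // [|n].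
  by apply: cvgB; exact: semigroup_resolvent_cvg.
have h0 := dyadic_gt0 (R := R) n.
pose y := series (euler_term S' l (2 ^- n) f) - series (euler_term S l (2 ^- n) f).
apply: (@cvgn_in_closed _ _ P y) => // [|N].
  by apply: cvgB; exact: euler_resolvent_cvg.
rewrite /y fctE !seriesEnat -sumrB; apply: (big_ind P) => //= k _.
rewrite /euler_term -scalerBr; apply: PZ; last by apply: PS; rewrite mulr_ge0// ltW.
by rewrite mulr_ge0 ?exprn_ge0 ?invr_ge0 ?addr_ge0 ?mulr_ge0 ?ltW.
Qed.

End contraction_semigroups.

Arguments euler_resolvent_cvg {R E S l}.
Arguments semigroup_resolvent_cvg {R E S l}.
Arguments semigroup_resolvent_generates {R E S l}.
Arguments generates_linear {R E S} c {x y g k}.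

(** * The Hille-Yosida theorem *)

(** Bundles a pointwise limit as a linear map inside a proof, where its linearity is only then
    established. *)
Lemma linear_packP {R : pzRingType} {U V : lmodType R} (f : U -> V) :
  linear f -> exists g : {linear U -> V}, g =1 f.
Proof.
move=> lf; pose m := GRing.isLinear.Build R U V *:%R f lf.
pose g : {linear U -> V} := HB.pack f m.
by exists g.
Qed.

(** * Binary digits and carries of rounded times *)

Section dyadic_floors.
Context {R : realType}.
Implicit Types (s t : R).

Lemma dyadic_floorS t n : 0 <= t -> exists2 b : nat, (b <= 1)%N &
  dyadic_floor t n.+1 = (b + 2 * dyadic_floor t n)%N.
Proof.
move=> t0; have p0 : 0 <= t * 2 ^+ n by rewrite mulr_ge0// exprn_ge0.
have p1 : 0 <= t * 2 ^+ n.+1 by rewrite mulr_ge0// exprn_ge0.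
have := truncn_itv p0; have := truncn_itv p1.
rewrite -!/(dyadic_floor _ _) exprS; set a := dyadic_floor t n.+1.
set b := dyadic_floor t n => /andP[h1 h2] /andP[h3 h4].
have h5 : (2 * b < a.+1)%N.
  rewrite -(ltr_nat R) natrM; apply: le_lt_trans h2.
  by rewrite mulrCA ler_pM2l.
have h6 : (a < 2 * b.+1)%N.
  rewrite -(ltr_nat R) natrM; apply: le_lt_trans h1 _.
  by rewrite mulrCA ltr_pM2l.
by exists (a - 2 * b)%N; clearbody a b; clear -h5 h6; lia.
Qed.

Lemma dyadic_floorD s t n : 0 <= s -> 0 <= t -> exists2 b : nat, (b <= 1)%N &
  dyadic_floor (s + t) n = (b + (dyadic_floor s n + dyadic_floor t n))%N.
Proof.
move=> s0 t0; have p0 : 0 <= s * 2 ^+ n by rewrite mulr_ge0// exprn_ge0.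
have p1 : 0 <= t * 2 ^+ n by rewrite mulr_ge0// exprn_ge0.
have p2 : 0 <= (s + t) * 2 ^+ n by rewrite mulr_ge0 ?addr_ge0// exprn_ge0.
have := truncn_itv p0; have := truncn_itv p1; have := truncn_itv p2.
rewrite -!/(dyadic_floor _ _) mulrDl; set a := dyadic_floor s n.
set b := dyadic_floor t n; set c := dyadic_floor (s + t) n.
rewrite -!natr1 => /andP[h1 h2] /andP[h3 h4] /andP[h5 h6].
have h7 : (a + b < c.+1)%N by rewrite -(ltr_nat R) natrD -natr1; lra.
have h8 : (c < a + b + 2)%N by rewrite -(ltr_nat R) !natrD; lra.
by exists (c - (a + b))%N; clearbody a b c; clear -h7 h8; lia.
Qed.

Lemma dyadic_floor_cvg t : 0 <= t ->
  (dyadic_floor t n)%:R * 2 ^- n @[n --> \oo] --> t.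
Proof.
move=> t0; apply/(@cvgn_normP R R^o) => e e0; have [N NP] := dyadic_small e0.
exists N => n Nn; rewrite ger0_norm; last by rewrite subr_ge0 dyadic_floor_le.
by rewrite (le_trans (dyadic_floor_gt _ t0))// NP.
Qed.

Lemma cauchyn_dyadic {E : normedModType R} (u : nat -> E) (C : R) :
  (forall n, `|u n - u n.+1| <= C * 2 ^- n) ->
  forall N n, (N <= n)%N -> `|u N - u n| <= 2 * C * 2 ^- N.
Proof.
move=> uC N n /subnKC <-; have C0 : 0 <= C.
  by have := uC 0%N; rewrite expr0 invr1 mulr1; apply: le_trans; exact: normr_ge0.
(* The sharper geometric sum is what the induction carries. *)
suff H j : `|u N - u (N + j)%N| <= 2 * C * (2 ^- N - 2 ^- (N + j)).
  apply: le_trans (H _) _; rewrite ler_wpM2l ?mulr_ge0//.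
  by rewrite lerBlDr lerDl ltW// dyadic_gt0.
elim: j => [|j IH]; first by rewrite addn0 !subrr normr0 mulr0.
rewrite (le_trans (ler_distD (u (N + j)%N) _ _))// addnS.
have := uC (N + j)%N; move: IH; rewrite (dyadicS (N + j)); lra.
Qed.

End dyadic_floors.

Section hille_yosida.
Context {R : realType} {E : completeNormedModType R}.
Variable Q : R -> {linear E -> E}.
Hypothesis Q_bound : forall l f, 0 < l -> l * `|Q l f| <= `|f|.
Hypothesis Q_resolvent : forall l m f, 0 < l -> 0 < m ->
  Q l f - Q m f = (m - l) *: Q m (Q l f).
Hypothesis Q_near : forall u e, 0 < e -> exists2 M, 0 < M &
  forall l, M <= l -> `|l *: Q l u - u| <= e.

(* The graph of the operator whose resolvent family is [Q]. *)
Let G (u g : E) := forall m, 0 < m -> Q m (m *: u - g) = u.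

Let GQ l f : 0 < l -> G (Q l f) (l *: Q l f - f).
Proof.
move=> l0 m m0; rewrite -[RHS](subrK (Q m f)) Q_resolvent//.
by rewrite !(linearB (Q m)) !(linearZ_LR (Q m)) /=; module_eq R.
Qed.

Let GD a u g u' g' : G u g -> G u' g' -> G (a *: u + u') (a *: g + g').
Proof.
move=> Gu Gu' m m0; rewrite -{2}(Gu m m0) -{2}(Gu' m m0).
by rewrite -linearP; congr (Q m _); module_eq R.
Qed.

(** The left side of the resolvent equation changes sign when [l] and [m] are exchanged. *)
Let Qcomm l m f : 0 < l -> 0 < m -> Q l (Q m f) = Q m (Q l f).
Proof.
move=> l0 m0; have [->//|lm] := eqVneq l m.
have ml : m - l != 0 by rewrite subr_eq0 eq_sym.
apply: (scalerI ml); rewrite -Q_resolvent// -[RHS]opprB.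
by rewrite Q_resolvent// -scaleNr opprB.
Qed.

(** This is $(1 - hA)^{-1}$ for the operator $A$ with graph [G]: one implicit Euler step of length
    [h]. *)
Let J h x := h^-1 *: Q h^-1 x.

Let JB h x y : J h (x - y) = J h x - J h y.
Proof. by rewrite /J (linearB (Q _)); module_eq R. Qed.

Let JD h x y : J h (x + y) = J h x + J h y.
Proof. by rewrite /J (linearD (Q _)); module_eq R. Qed.

Let JZ h a x : J h (a *: x) = a *: J h x.
Proof. by rewrite /J (linearZ_LR (Q _)); module_eq R. Qed.

Let J1 h x : 0 < h -> `|J h x| <= `|x|.
Proof.
by move=> h0; rewrite normrZ gtr0_norm ?invr_gt0// Q_bound// invr_gt0.
Qed.

Let Jcomm h k x : 0 < h -> 0 < k -> J h (J k x) = J k (J h x).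
Proof.
move=> h0 k0; rewrite /J (linearZ_LR (Q h^-1)) (linearZ_LR (Q k^-1)) /= Qcomm ?invr_gt0//.
by module_eq R.
Qed.

Let JG h u g : 0 < h -> G u g -> J h u - u = h *: J h g.
Proof.
move=> h0 /(_ h^-1); rewrite invr_gt0 => /(_ h0).
rewrite (linearB (Q _)) (linearZ_LR (Q _)) /J /= => e; rewrite -[in X in _ - X]e.
by rewrite scalerA divff ?gt_eqF// ; module_eq R.
Qed.

Let iterB h n x y :
  iter n (J h) (x - y) = iter n (J h) x - iter n (J h) y.
Proof. by elim: n => //= n ->; rewrite JB. Qed.

Let iterZ h n a x : iter n (J h) (a *: x) = a *: iter n (J h) x.
Proof. by elim: n => //= n ->; rewrite JZ. Qed.

Let iter1 h n x : 0 < h -> `|iter n (J h) x| <= `|x|.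
Proof. by move=> h0; elim: n => //= n; apply: le_trans; exact: J1. Qed.

Let JG_le h u g : 0 < h -> G u g -> `|J h u - u| <= h * `|g|.
Proof.
by move=> h0 /(JG h0) ->; rewrite normrZ gtr0_norm// ler_pM2l// J1.
Qed.

Let iterG_le h n u g : 0 < h -> G u g ->
  `|iter n (J h) u - u| <= n%:R * h * `|g|.
Proof.
move=> h0 Gu; elim: n => [|n IH]; first by rewrite /= subrr normr0 !mul0r.
have -> : iter n.+1 (J h) u - u =
    iter n (J h) (J h u - u) + (iter n (J h) u - u).
  by rewrite iterB -iterSr; module_eq R.
rewrite (le_trans (ler_normD _ _))//.
have := le_trans (iter1 n (J h u - u) h0) (JG_le h0 Gu).
by rewrite -natr1; lra.
Qed.

(** One step of length [2 * h] against two of length [h]: the first order terms cancel, which leaves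
    an error of second order when [u] is in the domain of $A^2$. The constant is $7 = 2 \cdot 2 + 1
    + 2$, from the three displacements of [v]. *)
Let J_half h u v w : 0 < h -> G u v -> G v w ->
  `|J (2 * h) u - J h (J h u)| <= 7 * (h * h * `|w|).
Proof.
move=> h0 Gu Gv; have hh : 0 < 2 * h by lra.
have e1 := JG hh Gu; have e2 := JG h0 Gu.
have -> : J (2 * h) u - J h (J h u) =
    h *: (2 *: (J (2 * h) v - v) - (J h v - v) - (iter 2 (J h) v - v)).
  have -> : J h (J h u) = u + h *: J h v + h *: J h (J h v).
    have e3 : J h u = u + h *: J h v by rewrite -e2 addrC subrK.
    by rewrite e3 JD JZ e3.
  have -> : J (2 * h) u = u + (2 * h) *: J (2 * h) v by rewrite -e1 addrC subrK.
  by rewrite /=; module_eq R.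
rewrite normrZ gtr0_norm//.
have a1 := JG_le hh Gv; have a2 := JG_le h0 Gv; have a3 := iterG_le 2 h0 Gv.
have b : `|2 *: (J (2 * h) v - v) - (J h v - v) - (iter 2 (J h) v - v)| <=
    7 * (h * `|w|).
  rewrite (le_trans (ler_normB _ _))//.
  have := ler_normB (2 *: (J (2 * h) v - v)) (J h v - v).
  rewrite normrZ ger0_norm//; lra.
by rewrite [leRHS](_ : _ = h * (7 * (h * `|w|))); [rewrite ler_pM2l|ring].
Qed.


Let iter_comm h k n m x : 0 < h -> 0 < k ->
  iter n (J h) (iter m (J k) x) = iter m (J k) (iter n (J h) x).
Proof.
move=> h0 k0; elim: n => //= n ->; elim: m => //= m <-.
by rewrite Jcomm.
Qed.

(** The steps commute and are contractions, so the local errors of the [n] double steps simply add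
    up. *)
Let iter_compare h n u : 0 < h ->
  `|iter n (J (2 * h)) u - iter (2 * n) (J h) u| <=
  n%:R * `|J (2 * h) u - J h (J h u)|.
Proof.
move=> h0; have hh : 0 < 2 * h by lra.
elim: n => [|n IH]; first by rewrite /= subrr normr0 mul0r.
have -> : iter n.+1 (J (2 * h)) u - iter (2 * n.+1) (J h) u =
    J (2 * h) (iter n (J (2 * h)) u - iter (2 * n) (J h) u) +
    iter (2 * n) (J h) (J (2 * h) u - J h (J h u)).
  rewrite mulnS iterB JB /= -(iter_comm 1 (2 * n) u hh h0) /=.
  by rewrite -!iterSr; module_eq R.
rewrite (le_trans (ler_normD _ _))//.
have := le_trans (J1 (iter n (J (2 * h)) u - iter (2 * n) (J h) u) hh) IH.
have := iter1 (2 * n) (J (2 * h) u - J h (J h u)) h0.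
by rewrite -natr1; lra.
Qed.

(* Implicit Euler scheme with step [2 ^- n]. *)
Let step (t : R) n u : E := iter (dyadic_floor `|t| n) (J (2 ^- n)) u.

(** Halving the step costs about [t / h] local errors of order [h * h], plus at most one extra step,
    of cost [h * |v|], when the next binary digit of [t] is 1. Both are of order [h], hence summable
    over dyadic steps. *)
Let step_smooth_cvg t u v w : G u v -> G v w -> exists C,
  forall N n, (N <= n)%N -> `|step t N u - step t n u| <= C * 2 ^- N.
Proof.
move=> Gu Gv; pose C := 7 * `|t| * `|w| + `|v|.
exists (2 * C); apply: cauchyn_dyadic => n.
have [b b1] := dyadic_floorS n (normr_ge0 t).
rewrite /step => ->; set m := dyadic_floor _ n.
have h0 := dyadic_gt0 (R := R) n.+1; rewrite dyadicS; set h := 2 ^- n.+1 in h0 *.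
have hm : m%:R * (2 * h) <= `|t| by rewrite -dyadicS dyadic_floor_le.
rewrite iterD -iter_comm//; set x := iter m _ u; set y := iter b _ u.
rewrite (le_trans (ler_distD (iter (2 * m) (J h) u) _ _))//.
have s1 := iter_compare m u h0; have s2 := J_half h0 Gu Gv.
have s3 : `|iter (2 * m) (J h) u - iter (2 * m) (J h) y| <= h * `|v|.
  rewrite -iterB (le_trans (iter1 _ _ h0))// distrC.
  rewrite (le_trans (iterG_le b h0 Gu))// ler_wpM2r// ler_piMl ?(ltW h0)//.
  by rewrite lern1.
have s4 : m%:R * `|J (2 * h) u - J h (J h u)| <= 7 * `|t| * `|w| * h.
  rewrite (le_trans (ler_wpM2l (ler0n _ _) s2))//.
  have := ler_wpM2r (mulr_ge0 (ltW h0) (normr_ge0 w)) hm.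
  have := mulr_ge0 (normr_ge0 t) (mulr_ge0 (ltW h0) (normr_ge0 w)); lra.
have := mulr_ge0 (normr_ge0 v) (ltW h0).
have := mulr_ge0 (mulr_ge0 (normr_ge0 t) (normr_ge0 w)) (ltW h0).
rewrite /C; move: s1 s3 s4; rewrite -/x; lra.
Qed.

Let GQZ l u : 0 < l -> G (l *: Q l u) (l *: (l *: Q l u - u)).
Proof.
move=> l0; have := GD l (GQ u l0) (_ : G 0 0); rewrite !addr0; apply.
by move=> m m0; rewrite scaler0 subr0 linear0.
Qed.

(** The witness is $(l Q_l)^2 u$ for large [l]. It lies in the domain of $A^2$, and the second
    factor, being a contraction, at most doubles the error of the first. *)
Let dense2 u e : 0 < e -> exists u' v w, [/\ G u' v, G v w & `|u - u'| <= e].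
Proof.
move=> e0; have [|l l0 /(_ l (lexx _)) lu] := @Q_near u (e / 2); first lra.
have [x xE] : exists x, x = l *: Q l u by exists (l *: Q l u).
pose y := l *: (x - u); rewrite -xE in lu.
exists (l *: Q l x), (l *: (l *: Q l x - x)), (l *: (l *: Q l y - y)).
split; first exact: GQZ.
  have -> : l *: (l *: Q l x - x) = l *: Q l y.
    by rewrite /y (linearZ_LR (Q l)) (linearB (Q l)) /= {2}xE; module_eq R.
  exact: GQZ.
rewrite (le_trans (ler_distD x _ _))// distrC.
have -> : x - l *: Q l x = - (l *: Q l (x - u)).
  by rewrite (linearB (Q l)) {1}xE; module_eq R.
rewrite normrN normrZ gtr0_norm//.
by have := Q_bound (x - u) l0; lra.
Qed.

Let stepB t n x y : step t n (x - y) = step t n x - step t n y.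
Proof. exact: iterB. Qed.

Let step1 t n x : `|step t n x| <= `|x|.
Proof. by apply: iter1; exact: dyadic_gt0. Qed.

Let step_is_cvg t u : cvgn (step t ^~ u).
Proof.
apply: cauchyn_cvg => e e0.
have [|u' [v [w [Gu Gv uu']]]] := @dense2 u (e / 3); first lra.
have [C CP] := step_smooth_cvg t Gu Gv.
have [|N NP] := @dyadic_small R (e / (3 * (`|C| + 1))).
  by rewrite divr_gt0 ?mulr_gt0//; have := normr_ge0 C; lra.
exists N => n Nn.
have -> : step t N u - step t n u = step t N (u - u') - step t n (u - u') +
   (step t N u' - step t n u') by rewrite !stepB; module_eq R.
rewrite (le_trans (ler_normD _ _))//.
have := ler_normB (step t N (u - u')) (step t n (u - u')).
have := step1 t N (u - u'); have := step1 t n (u - u').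
have := CP N n Nn; have := NP N (leqnn _); have := dyadic_gt0 (R := R) N.
have := normr_ge0 C; move: (2 ^- N) => h C0 h0 hC.
suff : C * h <= e / 3 by lra.
have C1 : 0 < `|C| + 1 by lra.
move: hC; rewrite ler_pdivlMr ?mulr_gt0//.
have := ler_norm C; nra.
Qed.

(** The absolute value in [step] makes this true for every real [t], so that [choice] yields a
    family indexed by [R]. *)
Let semigroup_ex t : exists W : {linear E -> E}, forall u,
  step t n u @[n --> \oo] --> W u.
Proof.
have [a x y|W WE] := @linear_packP _ E E (fun u => limn (step t ^~ u)).
  apply: (@cvgn_eq _ _ (step t ^~ (a *: x + y))); first exact: step_is_cvg.
  have -> : step t ^~ (a *: x + y) = (fun n => a *: step t n x + step t n y).
    apply/funext => n; rewrite -[y in LHS]opprK stepB.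
    rewrite -[- y]sub0r stepB /step iterZ.
    have -> : iter (dyadic_floor `|t| n) (J (2 ^- n)) 0 = 0.
      by have := iterZ (2 ^- n) (dyadic_floor `|t| n) 0 0; rewrite !scale0r.
    by module_eq R.
  apply: cvgD; last exact: step_is_cvg.
  by apply: cvgZr; exact: step_is_cvg.
by exists W => u; rewrite WE; exact: step_is_cvg.
Qed.


(** Each Euler step adds [h] times an iterate of [J] at [g], so the left side is a sum of [h] times
    the deviations of these iterates from [g]. *)
Let step_generates t n u g c : 0 <= t -> G u g ->
  (forall j, (j <= dyadic_floor t n)%N -> `|iter j (J (2 ^- n)) g - g| <= c) ->
  `|step t n u - u - ((dyadic_floor t n)%:R * 2 ^- n) *: g| <= t * c.
Proof.
move=> t0 Gu gc; have h0 := dyadic_gt0 (R := R) n.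
have c0 : 0 <= c by apply: le_trans (gc 0%N _); rewrite ?normr_ge0.
apply: (@le_trans _ _ ((dyadic_floor t n)%:R * 2 ^- n * c)); last first.
  by rewrite ler_wpM2r// dyadic_floor_le.
rewrite /step ger0_norm//; set h := 2 ^- n in gc h0 *.
elim: (dyadic_floor t n) gc => [|m IH] gc.
  by rewrite /= subrr !mul0r scale0r subr0 normr0.
have -> : iter m.+1 (J h) u - u - (m.+1%:R * h) *: g =
    (iter m (J h) u - u - (m%:R * h) *: g) + h *: (iter m.+1 (J h) g - g).
  have -> : h *: (iter m.+1 (J h) g - g) = iter m (J h) (J h u - u) - h *: g.
    by rewrite (JG h0 Gu) iterZ -iterSr scalerBr.
  by rewrite iterB -iterSr -natr1; module_eq R.
rewrite (le_trans (ler_normD _ _))// normrZ gtr0_norm//.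
have := ler_wpM2l (ltW h0) (gc m.+1 (leqnn _)).
have := IH (fun j jm => gc j (leqW jm)).
by rewrite -natr1; lra.
Qed.

(** The last clause is what transfers positivity from the resolvents to the semigroup: the
    approximants are products of positive multiples of resolvents. *)
Theorem hille_yosida : exists W : R -> {linear E -> E},
  [/\ contraction_semigroup W,
      forall l f, 0 < l -> generates W (Q l f) (l *: Q l f - f) &
      forall P : set E, closed P -> (forall a x, 0 <= a -> P x -> P (a *: x)) ->
        (forall l x, 0 < l -> P x -> P (Q l x)) ->
        forall t x, P x -> P (W t x)].
Proof.
have [W WE] := choice semigroup_ex.
have W1 t u : `|W t u| <= `|u|.
  apply: (@norm_cvgn_le _ _ (step t ^~ u) _ _ 0%N) => // n _; exact: step1.
have WG t u g : 0 <= t -> G u g -> `|W t u - u| <= t * `|g|.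
  move=> t0 Gu.
  apply: (@norm_cvgn_le _ _ (fun n => step t n u - u) _ _ 0%N) => [|n _].
    by apply: cvgB => //; exact: cvg_cst.
  rewrite (le_trans (iterG_le _ (dyadic_gt0 n) Gu))// ler_wpM2r//.
  by rewrite ger0_norm// dyadic_floor_le.
exists W; split.
- split=> [u|s t u s0 t0|t u _|u].
  + apply: (cvgn_eq (WE 0 u)); rewrite (_ : step 0 ^~ u = cst u).
      exact: cvg_cst.
    by apply/funext => n; rewrite /step /dyadic_floor normr0 mul0r Num.Theory.truncn0.
  + apply: (cvgn_eq (WE (s + t) u)); apply/cvgn_normP => e e0.
    (* The rounded [s + t] exceeds the sum of the rounded times by at most one step. Once [2 ^- n]
       is below the inverse of [M], that extra step moves [u] by at most [e / 4]. *)
    have e4 : 0 < e / 4 by lra.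
    have [N1 N1P] := (cvgn_normP _ _).1 (WE t u) _ e4.
    have [N2 N2P] := (cvgn_normP _ _).1 (WE s (W t u)) _ e4.
    have [M M0 MP] := @Q_near u _ e4.
    have [N3 N3P] := @dyadic_small R M^-1 ltac:(by rewrite invr_gt0).
    exists (maxn N1 (maxn N2 N3)) => n; rewrite !geq_max => /and3P[n1 n2 n3].
    have h0 := dyadic_gt0 (R := R) n.
    have J3 : `|J (2 ^- n) u - u| <= e / 4.
      by apply: MP; rewrite -(invrK M) lef_pV2 ?posrE ?invr_gt0// N3P.
    have [b b1 bE] := dyadic_floorD n s0 t0.
    have -> : step (s + t) n u =
        step s n (step t n (iter b (J (2 ^- n)) u)).
      rewrite /step !ger0_norm ?addr_ge0// bE !iterD.
      by rewrite iter_comm// (iter_comm b).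
    have -> : W s (W t u) - step s n (step t n (iter b (J (2 ^- n)) u)) =
        (W s (W t u) - step s n (W t u)) + step s n (W t u - step t n u) -
        step s n (step t n (iter b (J (2 ^- n)) u - u)).
      by rewrite !stepB; module_eq R.
    have s3 : `|step s n (step t n (iter b (J (2 ^- n)) u - u))| <= e / 4.
      rewrite (le_trans (step1 _ _ _))// (le_trans (step1 _ _ _))//.
      by clear bE; move: b b1 => [|[|//]] _ /=; rewrite ?subrr ?normr0// ltW.
    have s2 := le_trans (step1 s n (W t u - step t n u)) (N1P n n1).
    rewrite (le_trans (ler_normB _ _))//.
    have := ler_normD (W s (W t u) - step s n (W t u)) (step s n (W t u - step t n u)).
    have := N2P n n2; lra.
  + exact: W1.
  + apply/cvg_right0P => e e0.
    have [|u' [v [w [Gu Gv uu']]]] := @dense2 u (e / 4); first lra.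
    have v0 := normr_ge0 v; have d0 : 0 < e / (2 * (`|v| + 1)).
      by rewrite divr_gt0// mulr_gt0//; lra.
    exists (e / (2 * (`|v| + 1))) => // t t0 td.
    have -> : u - W t u = (u - u') - W t (u - u') - (W t u' - u').
      by rewrite (linearB (W t)); module_eq R.
    rewrite (le_trans (ler_normB _ _))//.
    have := ler_normB (u - u') (W t (u - u')).
    have := W1 t (u - u'); have := WG t _ _ (ltW t0) Gu.
    suff : t * `|v| <= e / 2 by lra.
    have v1 : 0 < `|v| + 1 by lra.
    by move: td; rewrite ler_pdivlMr ?mulr_gt0//; nra.
- move=> l f l0; have Gu := GQ f l0; set u := Q l f in Gu *; set g := _ - f in Gu *.
  apply/generatesP => e e0.
  (* [g] need not lie in the domain, so the deviation of its iterates is estimated through a nearby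
     [g'] that does. *)
  have [|g' [q [w [Gg Gq gg']]]] := @dense2 g (e / 4); first lra.
  have q0 := normr_ge0 q; have d0 : 0 < e / (2 * (`|q| + 1)).
    by rewrite divr_gt0// mulr_gt0//; lra.
  exists (e / (2 * (`|q| + 1))) => // t t0 td.
  have tq : t * `|q| <= e / 2.
    have q1 : 0 < `|q| + 1 by lra.
    by move: td; rewrite ler_pdivlMr ?mulr_gt0//; nra.
  apply: (@norm_cvgn_le _ _ (fun n => step t n u - u -
      ((dyadic_floor t n)%:R * 2 ^- n) *: g) _ _ 0%N).
    apply: cvgB; first by apply: cvgB => //; exact: cvg_cst.
    by apply: cvgZ; [exact: dyadic_floor_cvg (ltW t0)|exact: cvg_cst].
  move=> n _; rewrite [e * t]mulrC; apply: step_generates => //; first exact: ltW.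
  move=> j jn; have h0 := dyadic_gt0 (R := R) n.
  have -> : iter j (J (2 ^- n)) g - g = iter j (J (2 ^- n)) (g - g') -
      (g - g') + (iter j (J (2 ^- n)) g' - g').
    by rewrite iterB; module_eq R.
  rewrite (le_trans (ler_normD _ _))//.
  have := ler_normB (iter j (J (2 ^- n)) (g - g')) (g - g').
  have := iter1 j (g - g') h0; have := iterG_le j h0 Gg.
  have jt : j%:R * 2 ^- n <= t.
    rewrite (le_trans _ (dyadic_floor_le n (ltW t0)))// ler_pM2r//.
    by rewrite ler_nat.
  have := ler_wpM2r q0 jt; lra.
- move=> P cP PZ PQ t x Px; apply: (cvgn_in_closed cP (WE t x)) => n.
  have h0 := dyadic_gt0 (R := R) n; rewrite /step.
  elim: (dyadic_floor _ n) => //= m IH; rewrite /J.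
  by apply: PZ; [rewrite invr_ge0 ltW|apply: PQ => //; rewrite invr_gt0].
Qed.

End hille_yosida.

(** * Kato perturbation *)

(** The part of the structure of an abstract L-space that the Kato argument needs: a norm that is
    linear on the cone, and in place of lattice operations a decomposition on which the norm is
    additive. *)
Record al_cone {R : realType} {E : normedModType R} (P : set E) (psi : E -> R) :=
  AlCone {
    al_closed : closed P ;
    al_cone0 : P 0 ;
    al_coneD : forall x y, P x -> P y -> P (x + y) ;
    al_coneZ : forall a x, 0 <= a -> P x -> P (a *: x) ;
    al_linear : forall a x y, psi (a *: x + y) = a * psi x + psi y ;
    al_norm : forall x, P x -> psi x = `|x| ;
    al_decomp : forall x, exists p q,
      [/\ P p, P q, x = p - q & `|x| = `|p| + `|q| ] }.

(** * Order and functionals under a norm additive on the cone *)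

Section al_cone_theory.
Context {R : realType} {E : normedModType R} {P : set E} {psi : E -> R}.
Hypothesis alP : al_cone P psi.

Lemma al_psiD x y : psi (x + y) = psi x + psi y.
Proof. by rewrite -[x in LHS]scale1r (al_linear alP) mul1r. Qed.

Lemma al_psi0 : psi 0 = 0.
Proof. by have := al_psiD 0 0; rewrite addr0; lra. Qed.

Lemma al_psiZ a x : psi (a *: x) = a * psi x.
Proof. by rewrite -[a *: x]addr0 (al_linear alP) al_psi0 addr0. Qed.

Lemma al_psiB x y : psi (x - y) = psi x - psi y.
Proof. by rewrite -scaleN1r addrC (al_linear alP); ring. Qed.

Lemma al_psi_ge0 x : P x -> 0 <= psi x.
Proof. by move=> /(al_norm alP) ->. Qed.

Lemma al_psi_le x y : P (y - x) -> psi x <= psi y.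
Proof. by move=> /al_psi_ge0; rewrite al_psiB subr_ge0. Qed.

Lemma al_anti x : P x -> P (- x) -> x = 0.
Proof.
move=> Px Pnx; apply/eqP; rewrite -normr_le0 -(al_norm alP)//.
by have := al_psi_ge0 Pnx; rewrite -sub0r al_psiB al_psi0 sub0r oppr_ge0.
Qed.

(** The norm is monotone on the cone, where it equals [psi]. *)
Lemma al_dominated_cvg0 (x y : nat -> E) : (forall n, P (x n)) ->
  (forall n, P (y n - x n)) -> y @ \oo --> (0 : E) -> x @ \oo --> (0 : E).
Proof.
move=> Px Pyx y0; apply/cvgn_normP => e e0.
have [N NP] := (cvgn_normP y 0).1 y0 e e0; exists N => n /NP.
rewrite !sub0r !normrN; apply: le_trans.
have := al_psi_le (Pyx n); rewrite (al_norm alP (Px n)) (al_norm alP)//.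
by rewrite -(subrK (x n) (y n)); apply: (al_coneD alP).
Qed.

Section functionals.
Variable f : E -> R.
Hypothesis f_linear : forall a x y, f (a *: x + y) = a * f x + f y.
Hypothesis f_bound : forall x, P x -> 0 <= f x <= psi x.

Lemma al_functionalD x y : f (x + y) = f x + f y.
Proof. by rewrite -[x in LHS]scale1r f_linear mul1r. Qed.

Lemma al_functionalZ a x : f (a *: x) = a * f x.
Proof.
have f0 : f 0 = 0 by have := al_functionalD 0 0; rewrite addr0; lra.
by rewrite -[a *: x]addr0 f_linear f0 addr0.
Qed.

Lemma al_functionalB x y : f (x - y) = f x - f y.
Proof. by rewrite -scaleN1r addrC f_linear; ring. Qed.

Lemma al_functional_le x y : P (y - x) -> f x <= f y.
Proof. by move=> /f_bound/andP[+ _]; rewrite al_functionalB subr_ge0. Qed.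

Lemma al_functional_norm x : `|f x| <= `|x|.
Proof.
have [p [q [Pp Pq -> ->]]] := al_decomp alP x; rewrite al_functionalB.
have /andP[p0 pp] := f_bound Pp; have /andP[q0 qq] := f_bound Pq.
rewrite -(al_norm alP Pp) -(al_norm alP Pq) ler_norml.
by apply/andP; split; lra.
Qed.

Lemma al_functional_cvg (u : nat -> E) l : u @ \oo --> l ->
  f (u n) @[n --> \oo] --> f l.
Proof.
move=> ul; apply/(@cvgn_normP R R^o) => e e0.
have [N NP] := (cvgn_normP u l).1 ul e e0; exists N => n /NP.
by rewrite -al_functionalB; apply: le_trans; exact: al_functional_norm.
Qed.

End functionals.

Lemma al_psi_bound x : P x -> 0 <= psi x <= psi x.
Proof. by move=> Px; rewrite lexx al_psi_ge0. Qed.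

Lemma al_psi_cvg (u : nat -> E) l : u @ \oo --> l ->
  psi (u n) @[n --> \oo] --> psi l.
Proof. exact: (al_functional_cvg (al_linear alP) al_psi_bound). Qed.

End al_cone_theory.

(** The unperturbed operator enters only through its positive resolvent [r]; no semigroup is
    mentioned. *)
Record kato_setting {R : realType} {E : normedModType R} (P : set E) (psi : E -> R)
    (D : set E) (A B : E -> E) (r : R -> E -> E) : Prop := KatoSetting {
  kato_dom_linear : forall c x y, D x -> D y -> D (c *: x + y) ;
  kato_A_linear : forall c x y, D x -> D y -> A (c *: x + y) = c *: A x + A y ;
  kato_B_linear : forall c x y, D x -> D y -> B (c *: x + y) = c *: B x + B y ;
  kato_B_pos : forall x, D x -> P x -> P (B x) ;
  kato_dissipative : forall x, D x -> P x -> psi (A x + B x) <= 0 ;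
  kato_r_dom : forall l f, 0 < l -> D (r l f) ;
  kato_rE : forall l f, 0 < l -> l *: r l f - A (r l f) = f ;
  kato_rK : forall l x, 0 < l -> D x -> r l (l *: x - A x) = x ;
  kato_r_pos : forall l f, 0 < l -> P f -> P (r l f) ;
  kato_r_near : forall u e, 0 < e -> exists2 M, 0 < M &
  forall l, M <= l -> `|l *: r l u - u| <= e }.

(** * The Kato series, its resolvent and its mass defect *)

Section kato_perturbation.
Context {R : realType} {E : completeNormedModType R} {P : set E} {psi : E -> R}.
Hypothesis alP : al_cone P psi.
Variables (D : set E) (A B : E -> E) (r : R -> E -> E).
Hypothesis setting : kato_setting P psi D A B r.

Let D_linear : forall c x y, D x -> D y -> D (c *: x + y).
Proof. exact: (kato_dom_linear setting). Qed.
Let A_linear : forall c x y, D x -> D y -> A (c *: x + y) = c *: A x + A y.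
Proof. exact: (kato_A_linear setting). Qed.
Let B_linear : forall c x y, D x -> D y -> B (c *: x + y) = c *: B x + B y.
Proof. exact: (kato_B_linear setting). Qed.
Let B_pos : forall x, D x -> P x -> P (B x).
Proof. exact: (kato_B_pos setting). Qed.
Let AB_dissipative : forall x, D x -> P x -> psi (A x + B x) <= 0.
Proof. exact: (kato_dissipative setting). Qed.
Let r_dom : forall l f, 0 < l -> D (r l f).
Proof. exact: (kato_r_dom setting). Qed.
Let rE : forall l f, 0 < l -> l *: r l f - A (r l f) = f.
Proof. exact: (kato_rE setting). Qed.
Let rK : forall l x, 0 < l -> D x -> r l (l *: x - A x) = x.
Proof. exact: (kato_rK setting). Qed.
Let r_pos : forall l f, 0 < l -> P f -> P (r l f).
Proof. exact: (kato_r_pos setting). Qed.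
Let r_near : forall u e, 0 < e -> exists2 M, 0 < M &
  forall l, M <= l -> `|l *: r l u - u| <= e.
Proof. exact: (kato_r_near setting). Qed.

Definition kato_step l u := B (r l u).
Definition kato_term l u n := r l (iter n (kato_step l) u).
(** On [D] this is the functional $\mathfrak{a}$. *)
Definition kato_loss x := - psi (A x + B x).
Local Notation K := kato_step.
Local Notation T := kato_term.
Local Notation a := kato_loss.

Let D0 : D 0.
Proof. by have := D_linear (-1) (r_dom 0 ltr01) (r_dom 0 ltr01); rewrite scaleN1r addNr. Qed.

Let DZ c x : D x -> D (c *: x).
Proof. by move=> Dx; have := D_linear c Dx D0; rewrite addr0. Qed.

Let DD x y : D x -> D y -> D (x + y).
Proof. by move=> Dx Dy; have := D_linear 1 Dx Dy; rewrite scale1r. Qed.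

Let DB x y : D x -> D y -> D (x - y).
Proof. by move=> Dx Dy; have := D_linear (-1) Dy Dx; rewrite scaleN1r addrC. Qed.

Let A0 : A 0 = 0.
Proof. by have := A_linear (-1) D0 D0; rewrite scaler0 addr0 scaleN1r addNr. Qed.

Let B0 : B 0 = 0.
Proof. by have := B_linear (-1) D0 D0; rewrite scaler0 addr0 scaleN1r addNr. Qed.

Let r_lin l c f g : 0 < l -> r l (c *: f + g) = c *: r l f + r l g.
Proof.
move=> l0; have df := r_dom f l0; have dg := r_dom g l0.
rewrite -[RHS](@rK l) ?D_linear//; last exact: D_linear.
rewrite A_linear// -[f in LHS](rE f l0) -[g in LHS](rE g l0).
by congr (r l _); module_eq R.
Qed.

Let K_lin l c f g : 0 < l -> K l (c *: f + g) = c *: K l f + K l g.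
Proof. by move=> l0; rewrite /K r_lin// B_linear//; exact: r_dom. Qed.

Let iterK_lin l n c f g : 0 < l ->
  iter n (K l) (c *: f + g) = c *: iter n (K l) f + iter n (K l) g.
Proof. by move=> l0; elim: n => //= n ->; exact: K_lin. Qed.

Let T_lin l n c f g : 0 < l -> T l (c *: f + g) n = c *: T l f n + T l g n.
Proof. by move=> l0; rewrite /T iterK_lin// r_lin. Qed.

Let K_pos l f : 0 < l -> P f -> P (K l f).
Proof. by move=> l0 Pf; apply: B_pos; [exact: r_dom|exact: r_pos]. Qed.

Lemma kato_iter_pos l n f : 0 < l -> P f -> P (iter n (K l) f).
Proof. by move=> l0 Pf; elim: n => //= n; exact: K_pos. Qed.

Let T_pos l n f : 0 < l -> P f -> P (T l f n).
Proof. by move=> l0 Pf; apply: r_pos => //; exact: kato_iter_pos. Qed.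

Let T_dom l n f : 0 < l -> D (T l f n).
Proof. exact: r_dom. Qed.

Let a_lin c x y : D x -> D y -> a (c *: x + y) = c * a x + a y.
Proof.
move=> Dx Dy; rewrite /a A_linear// B_linear//.
have -> : c *: A x + A y + (c *: B x + B y) =
    c *: (A x + B x) + (A y + B y) by module_eq R.
by rewrite (al_linear alP); ring.
Qed.

Let aD x y : D x -> D y -> a (x + y) = a x + a y.
Proof. by move=> Dx Dy; rewrite -[x in LHS]scale1r a_lin// mul1r. Qed.

Let aB x y : D x -> D y -> a (x - y) = a x - a y.
Proof. by move=> Dx Dy; rewrite -scaleN1r addrC a_lin//; ring. Qed.

Let a0 : a 0 = 0.
Proof. by rewrite /a A0 B0 addr0 (al_psi0 alP) oppr0. Qed.

Let a_ge0 x : D x -> P x -> 0 <= a x.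
Proof. by move=> Dx Px; rewrite oppr_ge0 AB_dissipative. Qed.

(** Conservation of mass: write [iter N (K l) u] as [l *: x - A x] with [x] the next term, and [psi]
    of it splits into retained mass, mass passed on and loss. For [u] in the cone all three are
    nonnegative, which gives every bound below; the limit of the middle one is the defect. *)
Lemma kato_balance l u N : 0 < l ->
  l * psi (series (T l u) N) + psi (iter N (K l) u) +
    series (a \o T l u) N = psi u.
Proof.
move=> l0; elim: N => [|N <-].
  by rewrite !seriesEnat /= !big_geq// (al_psi0 alP); ring.
rewrite !seriesSr (al_psiD alP) -[in RHS](rE (iter N (K l) u) l0).
rewrite (al_psiB alP) (al_psiZ alP) /= /a (al_psiD alP) -/(K l _).
by rewrite /T; ring.
Qed.

Lemma kato_series_dom l u N : 0 < l -> D (series (T l u) N).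
Proof.
move=> l0; rewrite seriesEnat; by apply: (big_ind D) => // i _; exact: T_dom.
Qed.

Let series_pos l u N : 0 < l -> P u -> P (series (T l u) N).
Proof.
move=> l0 Pu; rewrite seriesEnat; apply: (big_ind P) => //.
- exact: (al_cone0 alP).
- exact: (al_coneD alP).
- by move=> i _; exact: T_pos.
Qed.

Let a_series l u N : 0 < l -> series (a \o T l u) N = a (series (T l u) N).
Proof.
move=> l0; elim: N => [|N IH]; first by rewrite !seriesEnat /= !big_geq.
by rewrite !seriesSr IH aD//; [exact: kato_series_dom|exact: T_dom].
Qed.

Let series_lin l c f g : 0 < l ->
  series (T l (c *: f + g)) = (fun N => c *: series (T l f) N + series (T l g) N).
Proof.
move=> l0; apply/funext => N; rewrite !seriesEnat /= scaler_sumr -big_split /=.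
by apply: eq_bigr => i _; exact: T_lin.
Qed.

Let series_a_lin l c f g : 0 < l -> series (a \o T l (c *: f + g)) =
  (fun N => c * series (a \o T l f) N + series (a \o T l g) N).
Proof.
move=> l0; apply/funext => N; rewrite !a_series// series_lin//= a_lin//; exact: kato_series_dom.
Qed.

Let series_a_ge0 l u N : 0 < l -> P u -> 0 <= series (a \o T l u) N.
Proof. by move=> l0 Pu; rewrite a_series// a_ge0//; [exact: kato_series_dom|exact: series_pos]. Qed.

Let series_a_le l u N : 0 < l -> P u -> series (a \o T l u) N <= psi u.
Proof.
move=> l0 Pu; rewrite -(kato_balance u N l0) lerDr addr_ge0 ?mulr_ge0 ?(ltW l0)//.
  by apply: (al_psi_ge0 alP); exact: series_pos.
by apply: (al_psi_ge0 alP); exact: kato_iter_pos.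
Qed.

Let series_psi_le l u N : 0 < l -> P u -> l * psi (series (T l u) N) <= psi u.
Proof.
move=> l0 Pu; rewrite -[leRHS](kato_balance u N l0) -addrA lerDl addr_ge0 ?series_a_ge0//.
by apply: (al_psi_ge0 alP); exact: kato_iter_pos.
Qed.

Let series_cvg l u : 0 < l -> cvgn (series (T l u)).
Proof.
move=> l0; have [p [q [Pp Pq -> _]]] := al_decomp alP u.
have cvgP w : P w -> cvgn (series (T l w)).
  move=> Pw; apply: normed_cvg.
  (* The norm is additive on the cone, so absolute convergence reduces to a bounded monotone real
     sequence. *)
  have -> : [normed series (T l w)] = (fun N => psi (series (T l w) N)).
    apply/funext => N /=; elim: N => [|N IH].
      by rewrite !seriesEnat /= !big_geq// (al_psi0 alP).
    by rewrite !seriesSr (al_psiD alP) -IH (al_norm alP (T_pos _ l0 Pw)).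
  apply: nondecreasing_is_cvgn.
    apply/nondecreasing_seqP => n; rewrite seriesSr (al_psiD alP) lerDl.
    by apply: (al_psi_ge0 alP); exact: T_pos.
  exists (psi w / l) => _ [N _ <-].
  by rewrite ler_pdivlMr// mulrC series_psi_le.
have -> : p - q = (-1) *: q + p by module_eq R.
by rewrite series_lin//; apply: is_cvgD; [apply: is_cvgZr|]; exact: cvgP.
Qed.

Let series_a_cvg l u : 0 < l -> cvgn (series (a \o T l u)).
Proof.
move=> l0; have [p [q [Pp Pq -> _]]] := al_decomp alP u.
have cvgP w : P w -> cvgn (series (a \o T l w)).
  move=> Pw; apply: nondecreasing_is_cvgn.
    apply/nondecreasing_seqP => n; rewrite seriesSr lerDl /=.
    by apply: a_ge0; [exact: T_dom|exact: T_pos].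
  by exists (psi w) => _ [N _ <-]; exact: series_a_le.
have -> : p - q = (-1) *: q + p by module_eq R.
by rewrite series_a_lin//; apply: is_cvgD; [apply: is_cvgMl_tmp|]; exact: cvgP.
Qed.


Let kato_resolvent_ex l : exists Q : {linear E -> E}, 0 < l ->
  forall u, series (T l u) @ \oo --> Q u.
Proof.
have [l0|l0] := ltP 0 l; last by exists idfun.
have [c x y|Q QE] := @linear_packP _ E E (fun u => limn (series (T l u))).
  apply: (@cvgn_eq _ _ (series (T l (c *: x + y)))); first exact: series_cvg.
  rewrite series_lin//; apply: cvgD; last exact: series_cvg.
  by apply: cvgZr; exact: series_cvg.
by exists Q => _ u; rewrite QE; exact: series_cvg.
Qed.

Definition kato_resolvent l : {linear E -> E} := projT1 (cid (kato_resolvent_ex l)).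
Local Notation Q := kato_resolvent.

Lemma kato_resolvent_cvg l u : 0 < l -> series (T l u) @ \oo --> Q l u.
Proof. by rewrite /Q; case: cid => q /= + l0; exact. Qed.
Arguments kato_resolvent_cvg : clear implicits.

Lemma kato_resolvent_pos l u : 0 < l -> P u -> P (Q l u).
Proof.
move=> l0 Pu; apply: (cvgn_in_closed (al_closed alP) (kato_resolvent_cvg l u l0)).
by move=> N; exact: series_pos.
Qed.

Let Q_psi l u : 0 < l -> P u -> l * psi (Q l u) <= psi u.
Proof.
move=> l0 Pu; rewrite -ler_pdivlMl// (al_norm alP); last exact: kato_resolvent_pos.
apply: (norm_cvgn_le (N := 0%N) (kato_resolvent_cvg l u l0)) => N _.
rewrite -(al_norm alP); last exact: series_pos.
by rewrite ler_pdivlMl// series_psi_le.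
Qed.

Lemma kato_resolvent_bound l u : 0 < l -> l * `|Q l u| <= `|u|.
Proof.
move=> l0; have [p [q [Pp Pq -> ->]]] := al_decomp alP u.
rewrite (linearB (Q l)) (le_trans (ler_wpM2l (ltW l0) (ler_normB _ _)))//.
have := Q_psi l0 Pp; have := Q_psi l0 Pq.
rewrite (al_norm alP Pp) (al_norm alP Pq).
rewrite (al_norm alP (kato_resolvent_pos l0 Pp)).
rewrite (al_norm alP (kato_resolvent_pos l0 Pq)); lra.
Qed.

Let Q_cvg l (u : nat -> E) x : 0 < l -> u @ \oo --> x ->
  Q l (u n) @[n --> \oo] --> Q l x.
Proof.
move=> l0 ux; apply/cvgn_normP => e e0.
have [N NP] := (cvgn_normP u x).1 ux _ (mulr_gt0 l0 e0).
exists N => n /NP un; rewrite -(linearB (Q l)) -(ler_pM2l l0).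
exact: le_trans (kato_resolvent_bound _ l0) un.
Qed.

Let TK l x n : 0 < l -> D x -> T l (l *: x - A x) n.+1 = T l (B x) n.
Proof. by move=> l0 Dx; rewrite /T iterSr /K rK. Qed.

Let seriesT l x N : 0 < l -> D x ->
  series (T l (l *: x - A x)) N.+1 = x + series (T l (B x)) N.
Proof.
move=> l0 Dx; elim: N => [|N IH].
  by rewrite seriesSr !seriesEnat /= !big_geq// add0r addr0 /T /= rK.
by rewrite seriesSr IH TK// [in RHS]seriesSr addrA.
Qed.

(** The series at [l *: x - A x] starts with [x] and continues as the series at [B x]. *)
Lemma kato_resolventK l x : 0 < l -> D x -> Q l (l *: x - (A x + B x)) = x.
Proof.
move=> l0 Dx; have -> : l *: x - (A x + B x) = l *: x - A x - B x by module_eq R.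
rewrite (linearB (Q l)); apply/eqP; rewrite subr_eq; apply/eqP.
apply: (@cvgn_eq _ _ (fun N => series (T l (l *: x - A x)) N.+1)).
  rewrite (cvg_shiftS (series (T l (l *: x - A x)))).
  exact: kato_resolvent_cvg.
rewrite (_ : (fun N => _) = (fun N => x + series (T l (B x)) N)).
  by apply: cvgD; [exact: cvg_cst|exact: kato_resolvent_cvg].
by apply/funext => N; exact: seriesT.
Qed.

Let series_tail l u N M : series (T l (iter N (K l) u)) M =
  series (T l u) (N + M)%N - series (T l u) N.
Proof.
elim: M => [|M IH]; first by rewrite addn0 subrr seriesEnat /= big_geq.
rewrite addnS !seriesSr IH /T -iterD [(M + N)%N]addnC.
by module_eq R.
Qed.

(** Applying [Q l] to the [N]-th iterate gives the tail of the convergent series after [N] terms. *)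
Let Q_tail l u : 0 < l -> Q l (iter N (K l) u) @[N --> \oo] --> (0 : E).
Proof.
move=> l0; rewrite (_ : (fun N => _) = (fun N => Q l u - series (T l u) N)).
  rewrite -[0](subrr (Q l u)); apply: cvgB; first exact: cvg_cst.
  exact: kato_resolvent_cvg.
apply/funext => N; apply: (cvgn_eq (kato_resolvent_cvg l _ l0)).
rewrite (_ : series _ = fun M => series (T l u) (N + M)%N - series (T l u) N).
  apply: cvgB; last exact: cvg_cst.
  have := kato_resolvent_cvg l u l0; rewrite -(cvg_shiftn N).
  by under eq_fun do rewrite addnC.
by apply/funext => M; exact: series_tail.
Qed.

Let r_mono l m u : 0 < l -> 0 < m -> r l u - r m u = (m - l) *: r l (r m u).
Proof.
move=> l0 m0; have Dw := r_dom u m0.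
have {1}-> : u = (m - l) *: r m u + (l *: r m u - A (r m u)).
  by rewrite -[in LHS](rE u m0); module_eq R.
by rewrite r_lin// rK// addrK.
Qed.

Let r_le l m u : 0 < l -> l <= m -> P u -> P (r l u - r m u).
Proof.
move=> l0 lm Pu; have m0 := lt_le_trans l0 lm; rewrite r_mono//.
by apply: (al_coneZ alP); rewrite ?subr_ge0//; apply: r_pos => //; exact: r_pos.
Qed.

Let iterK_le l m n u : 0 < l -> l <= m -> P u ->
  P (iter n (K l) u - iter n (K m) u).
Proof.
move=> l0 lm Pu; have m0 := lt_le_trans l0 lm.
elim: n => [|n IH] /=; first by rewrite subrr; exact: (al_cone0 alP).
set x := iter n (K l) u in IH *; set y := iter n (K m) u in IH *.
have Py : P y by exact: kato_iter_pos.
have -> : K l x - K m y = K l (x - y) + B (r l y - r m y).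
  have Kl : K l x = K l (x - y) + K l y.
    by have := K_lin 1 (x - y) y l0; rewrite !scale1r subrK.
  rewrite Kl -addrA; congr (_ + _); have := B_linear (-1) (r_dom y m0) (r_dom y l0).
  by rewrite !scaleN1r addrC [- r m y + _]addrC => ->; rewrite addrC.
apply: (al_coneD alP); first exact: K_pos.
by apply: B_pos; [apply: DB; exact: r_dom|exact: r_le].
Qed.

Let T_le_split l m n u : 0 < l -> 0 < m -> T l u n - T m u n =
  r l (iter n (K l) u - iter n (K m) u) +
  (r l (iter n (K m) u) - r m (iter n (K m) u)).
Proof.
move=> l0 m0; rewrite /T; set x := iter n (K l) u; set y := iter n (K m) u.
have -> : r l x = r l (x - y) + r l y.
  by have := r_lin 1 (x - y) y l0; rewrite !scale1r subrK.
by module_eq R.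
Qed.

Let T_le l m n u : 0 < l -> l <= m -> P u -> P (T l u n - T m u n).
Proof.
move=> l0 lm Pu; have m0 := lt_le_trans l0 lm; rewrite T_le_split//.
apply: (al_coneD alP); first by apply: r_pos => //; exact: iterK_le.
by apply: r_le => //; exact: kato_iter_pos.
Qed.

Let Q_le l m u : 0 < l -> l <= m -> P u -> P (Q l u - Q m u).
Proof.
move=> l0 lm Pu; have m0 := lt_le_trans l0 lm.
apply: (@cvgn_in_closed _ _ P (series (T l u) - series (T m u)) _ (al_closed alP)).
  by apply: cvgB; exact: kato_resolvent_cvg.
move=> N; rewrite fctE !seriesEnat -sumrB; apply: (big_ind P) => //.
- exact: (al_cone0 alP).
- exact: (al_coneD alP).
- by move=> n _; exact: T_le.
Qed.

(** If [l <= m], replace [Q m] by the larger [Q l]; otherwise replace the iterates for [l] by the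
    larger ones for [m]. Either way an unmixed tail dominates. *)
Let Q_tail_any l m u : 0 < l -> 0 < m -> P u ->
  Q m (iter N (K l) u) @[N --> \oo] --> (0 : E).
Proof.
move=> l0 m0 Pu; have PQ N : P (Q m (iter N (K l) u)).
  by apply: kato_resolvent_pos => //; exact: kato_iter_pos.
have [lm|/ltW ml] := leP l m.
  apply: (al_dominated_cvg0 alP PQ _ (Q_tail u l0)) => N.
  by apply: Q_le => //; exact: kato_iter_pos.
apply: (al_dominated_cvg0 alP PQ _ (Q_tail u m0)) => N.
by rewrite -(linearB (Q m)); apply: kato_resolvent_pos => //; exact: iterK_le.
Qed.

Lemma kato_series_eq l u N : 0 < l -> let w := series (T l u) N in
  l *: w - (A w + B w) = u - iter N (K l) u.
Proof.
move=> l0; rewrite /=; elim: N => [|N IH].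
  by rewrite seriesEnat /= big_geq// A0 B0 scaler0 addr0 !subrr.
have DT : D (T l u N) by exact: T_dom.
have DS : D (series (T l u) N) by exact: kato_series_dom.
rewrite seriesSr; set w := series _ _ in IH DS *; set x := T l u N in DT *.
have Aw : A (w + x) = A w + A x by rewrite -[w in LHS]scale1r A_linear// scale1r.
have Bw : B (w + x) = B w + B x by rewrite -[w in LHS]scale1r B_linear// scale1r.
have -> : l *: (w + x) - (A (w + x) + B (w + x)) =
    (l *: w - (A w + B w)) + (l *: x - A x) - B x.
  by rewrite Aw Bw; module_eq R.
by rewrite IH /x /T rE// subrK.
Qed.

Let shifted_eq l m u N : 0 < l -> let w := series (T l u) N in
  m *: w - (A w + B w) = u - iter N (K l) u + (m - l) *: w.
Proof. by move=> l0 /=; rewrite -kato_series_eq//=; module_eq R. Qed.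

(** Apply [Q m] to the equation of the partial sums, rewritten for the parameter [m]; the remainder
    is the mixed tail. *)
Lemma kato_resolvent_eq l m u : 0 < l -> 0 < m ->
  Q l u - Q m u = (m - l) *: Q m (Q l u).
Proof.
move=> l0 m0; have main p : P p -> Q l p - Q m p = (m - l) *: Q m (Q l p).
  move=> Pp; apply/eqP; rewrite subr_eq addrC; apply/eqP.
  apply: (cvgn_eq (kato_resolvent_cvg l p l0)).
  rewrite (_ : series _ = fun N => Q m p - Q m (iter N (K l) p) +
      (m - l) *: Q m (series (T l p) N)).
    apply: cvgD; last by apply: cvgZr; apply: Q_cvg => //; exact: kato_resolvent_cvg.
    by rewrite -[X in _ --> X]subr0; apply: cvgB; [exact: cvg_cst|exact: Q_tail_any].
  apply/funext => N; rewrite -[LHS](kato_resolventK m0 (kato_series_dom p N l0)).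
  by rewrite shifted_eq// (linearD (Q m)) (linearB (Q m)) (linearZ_LR (Q m)).
have [p [q [Pp Pq -> _]]] := al_decomp alP u.
rewrite !(linearB (Q l)) !(linearB (Q m)) scalerBr -!main//.
by module_eq R.
Qed.

Lemma kato_resolvent_near u e : 0 < e -> exists2 M, 0 < M &
  forall l, M <= l -> `|l *: Q l u - u| <= e.
Proof.
move=> e0; have [|M M0 /(_ M (lexx _)) Mu] := @r_near u (e / 3); first lra.
(* The claim is direct on [D], where the displacement is [Q l (A w + B w)], of norm at most
   [|v| / l]; contractivity carries it to [u]. *)
pose w := M *: r M u; have Dw : D w by apply: DZ; exact: r_dom.
set v := A w + B w; have v0 := normr_ge0 v.
exists (3 * (`|v| + 1) / e) => [|l Ml]; first by rewrite divr_gt0//; lra.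
have l0 : 0 < l by apply: lt_le_trans Ml; rewrite divr_gt0//; lra.
have Qw : `|l *: Q l w - w| <= e / 3.
  have -> : l *: Q l w - w = Q l v.
    have e1 := kato_resolventK l0 Dw; rewrite (linearB (Q l)) (linearZ_LR (Q l)) in e1.
    by rewrite -[in X in _ - X]e1 -/v; module_eq R.
  rewrite -(ler_pM2l l0) (le_trans (kato_resolvent_bound _ l0))//.
  by move: Ml; rewrite ler_pdivrMr//; lra.
have -> : l *: Q l u - u = (l *: Q l w - w) - l *: Q l (w - u) + (w - u).
  by rewrite (linearB (Q l)); module_eq R.
rewrite (le_trans (ler_normD _ _))//.
have := ler_normB (l *: Q l w - w) (l *: Q l (w - u)).
rewrite [X in _ <= _ + X]normrZ gtr0_norm//.
have := kato_resolvent_bound (w - u) l0; rewrite -/w in Mu; lra.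
Qed.

(** The value of $\overline{\mathfrak{a}}$ at [Q l u], still depending on [l] in its form. *)
Definition kato_alpha l u : R := limn (series (a \o T l u)).
Local Notation alpha := kato_alpha.

Lemma kato_alpha_cvg l u : 0 < l -> series (a \o T l u) @ \oo --> alpha l u.
Proof. exact: series_a_cvg. Qed.
Arguments kato_alpha_cvg : clear implicits.

Let alpha_lin l c x y : 0 < l -> alpha l (c *: x + y) = c * alpha l x + alpha l y.
Proof.
move=> l0; apply: (@cvgn_eq _ R^o _ _ _ (kato_alpha_cvg l (c *: x + y) l0)).
rewrite series_a_lin//; apply: (@cvgD _ R^o); last exact: kato_alpha_cvg.
by apply: (@cvgZr _ R^o); exact: kato_alpha_cvg.
Qed.

Let alpha_bound l u : 0 < l -> P u -> 0 <= alpha l u <= psi u.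
Proof.
move=> l0 Pu; apply/andP; split.
  apply: (@cvgn_in_closed _ R^o [set x | 0 <= x] _ _ _ (kato_alpha_cvg l u l0)).
    exact: closed_ge.
  by move=> N; exact: series_a_ge0.
apply: (@cvgn_in_closed _ R^o [set x | x <= psi u] _ _ _ (kato_alpha_cvg l u l0)).
  exact: closed_le.
by move=> N; exact: series_a_le.
Qed.

Let alphaK l x : 0 < l -> D x -> alpha l (l *: x - (A x + B x)) = a x.
Proof.
move=> l0 Dx; have -> : l *: x - (A x + B x) = l *: x - A x - B x by module_eq R.
rewrite (al_functionalB (fun c y z => @alpha_lin l c y z l0)).
apply/eqP; rewrite subr_eq; apply/eqP.
apply: (@cvgn_eq _ R^o (fun N => series (a \o T l (l *: x - A x)) N.+1)).
  rewrite (cvg_shiftS (series (a \o T l (l *: x - A x)))).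
  exact: kato_alpha_cvg.
rewrite (_ : (fun N => _) = (fun N => a x + series (a \o T l (B x)) N)).
  by apply: (@cvgD _ R^o); [exact: cvg_cst|exact: kato_alpha_cvg].
apply/funext => N; rewrite !a_series// seriesT// aD//; exact: kato_series_dom.
Qed.

Let a_T_le l m n u : 0 < l -> l <= m -> P u -> a (T m u n) <= a (T l u n).
Proof.
move=> l0 lm Pu; have m0 := lt_le_trans l0 lm.
rewrite -subr_ge0 -aB; [|exact: T_dom|exact: T_dom].
by apply: a_ge0; [apply: DB; exact: T_dom|exact: T_le].
Qed.

Let alpha_le l m u : 0 < l -> l <= m -> P u -> alpha m u <= alpha l u.
Proof.
move=> l0 lm Pu; have m0 := lt_le_trans l0 lm; rewrite -subr_ge0.
pose d := series (a \o T l u) - series (a \o T m u).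
apply: (@cvgn_in_closed _ R^o [set x | 0 <= x] d).
- exact: closed_ge.
- by apply: (@cvgB _ R^o); exact: kato_alpha_cvg.
- move=> N; rewrite /d fctE /= !seriesEnat -sumrB sumr_ge0// => n _ /=.
  by rewrite subr_ge0 a_T_le.
Qed.

Let series_a_tail l u N M : series (a \o T l (iter N (K l) u)) M =
  series (a \o T l u) (N + M)%N - series (a \o T l u) N.
Proof.
elim: M => [|M IH]; first by rewrite addn0 subrr seriesEnat /= big_geq.
by rewrite addnS !seriesSr IH /= /T -iterD [(M + N)%N]addnC; ring.
Qed.

Let alpha_tail l u N : 0 < l ->
  alpha l (iter N (K l) u) = alpha l u - series (a \o T l u) N.
Proof.
move=> l0; apply: (@cvgn_eq _ R^o _ _ _ (kato_alpha_cvg l _ l0)).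
rewrite (_ : series _ =
    fun M => series (a \o T l u) (N + M)%N - series (a \o T l u) N).
  apply: (@cvgB _ R^o); last exact: cvg_cst.
  have := kato_alpha_cvg l u l0; rewrite -(cvg_shiftn N).
  by under eq_fun do rewrite addnC.
by apply/funext => M; exact: series_a_tail.
Qed.

(** The same two-case domination as for [Q_tail_any], now by tails of the real series that defines
    [alpha]. *)
Let alpha_tail_cvg l m u : 0 < l -> 0 < m -> P u ->
  alpha m (iter N (K l) u) @[N --> \oo] --> (0 : R).
Proof.
move=> l0 m0 Pu.
have dom k : 0 < k ->
    (forall N, alpha m (iter N (K l) u) <= alpha k (iter N (K k) u)) ->
    alpha m (iter N (K l) u) @[N --> \oo] --> (0 : R).
  move=> k0 mk; apply: (@squeeze_cvgr _ _ _ _ (cst 0)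
    (fun N => alpha k u - series (a \o T k u) N)).
  - near=> N; rewrite -alpha_tail// mk andbT.
    by have /andP[] := alpha_bound m0 (kato_iter_pos N l0 Pu).
  - exact: cvg_cst.
  - rewrite -[X in _ --> X](subrr (alpha k u)).
    by apply: (@cvgB _ R^o); [exact: cvg_cst|exact: kato_alpha_cvg].
have [lm|/ltW ml] := leP l m.
  apply: (dom l) => // N; apply: alpha_le => //; exact: kato_iter_pos.
apply: (dom m) => // N.
apply: (@al_functional_le _ _ P psi (alpha m)).
- by move=> c x y; exact: alpha_lin.
- by move=> x; exact: alpha_bound.
- exact: iterK_le.
Unshelve. all: by end_near. Qed.

(** The argument on the right is the vector that [Q m] also sends to [Q l u], so this says that
    $\overline{\mathfrak{a}}$ does not depend on the parameter. It follows by applying [alpha m] to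
    the equation of the partial sums. *)
Lemma kato_alpha_invariant l m u : 0 < l -> 0 < m ->
  alpha l u = alpha m (u + (m - l) *: Q l u).
Proof.
move=> l0 m0; have alm := fun c y z => @alpha_lin m c y z m0.
have main p : P p -> alpha l p = alpha m (p + (m - l) *: Q l p).
  move=> Pp; apply: (@cvgn_eq _ R^o _ _ _ (kato_alpha_cvg l p l0)).
  rewrite (_ : series _ = fun N => alpha m p - alpha m (iter N (K l) p) +
      (m - l) * alpha m (series (T l p) N)).
    rewrite (al_functionalD alm) (al_functionalZ alm); apply: (@cvgD _ R^o).
      by rewrite -[X in _ --> X]subr0; apply: (@cvgB _ R^o);
        [exact: cvg_cst|exact: alpha_tail_cvg].
    apply: (@cvgZr _ R^o); apply: (al_functional_cvg alP alm).
      by move=> x; exact: alpha_bound.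
    exact: kato_resolvent_cvg.
  apply/funext => N; rewrite a_series// -[LHS](alphaK m0 (kato_series_dom p N l0)).
  by rewrite shifted_eq// (al_functionalD alm) (al_functionalB alm) (al_functionalZ alm).
have [p [q [Pp Pq -> _]]] := al_decomp alP u.
have -> : p - q + (m - l) *: Q l (p - q) =
    (p + (m - l) *: Q l p) - (q + (m - l) *: Q l q).
  by rewrite (linearB (Q l)); module_eq R.
rewrite (al_functionalB alm) -!main//.
by rewrite (al_functionalB (fun c y z => @alpha_lin l c y z l0)).
Qed.

Definition kato_defect l u := psi u - l * psi (Q l u) - alpha l u.

Lemma kato_defect_linear l c x y : 0 < l ->
  kato_defect l (c *: x + y) = c * kato_defect l x + kato_defect l y.
Proof.
move=> l0; rewrite /kato_defect alpha_lin// (linearP (Q l)) !(al_linear alP).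
ring.
Qed.

Lemma kato_defect_bound l u : 0 < l -> P u -> 0 <= kato_defect l u <= psi u.
Proof.
move=> l0 Pu; have /andP[al0 _] := alpha_bound l0 Pu; apply/andP; split.
  (* By [kato_balance] the defect is the limit of [psi (iter N (K l) u)], which is nonnegative. *)
  apply: (@cvgn_in_closed _ R^o [set x | 0 <= x] (fun N =>
      psi u - l * psi (series (T l u) N) - series (a \o T l u) N)).
  - exact: closed_ge.
  - apply: (@cvgB _ R^o); last exact: kato_alpha_cvg.
    apply: (@cvgB _ R^o); first exact: cvg_cst.
    apply: (@cvgZr _ R^o); apply: (al_psi_cvg alP).
    exact: kato_resolvent_cvg.
  - move=> N /=; rewrite -(kato_balance u N l0).
    by have := al_psi_ge0 alP (kato_iter_pos N l0 Pu); lra.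
have := mulr_ge0 (ltW l0) (al_psi_ge0 alP (kato_resolvent_pos l0 Pu)).
by rewrite /kato_defect; lra.
Qed.

End kato_perturbation.

(** * The space of signed measures *)

Section signed_measure_values.
Context {d} {T : measurableType d} {R : realType}.
Implicit Types (mu nu : signed_measure T R) (A B : set T).

Definition sm_value mu A : R := fine (mu A).

Lemma sm_valueE mu A : measurable A -> mu A = (sm_value mu A)%:E.
Proof. by move=> mA; rewrite sm_finE. Qed.

Lemma sm_value_set0 mu : sm_value mu set0 = 0.
Proof. by rewrite /sm_value charge0. Qed.

Lemma sm_valueD mu nu A : measurable A ->
  sm_value (mu + nu) A = sm_value mu A + sm_value nu A.
Proof. by move=> mA; rewrite /sm_value signed_measureD fineD// fin_num_measure. Qed.

Lemma sm_valueZ a mu A : measurable A -> sm_value (a *: mu) A = a * sm_value mu A.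
Proof. by move=> mA; rewrite /sm_value signed_measureZ fineM// fin_num_measure. Qed.

Lemma sm_valueN mu A : measurable A -> sm_value (- mu) A = - sm_value mu A.
Proof. by move=> mA; rewrite -scaleN1r sm_valueZ// mulN1r. Qed.

Lemma sm_valueB mu nu A : measurable A ->
  sm_value (mu - nu) A = sm_value mu A - sm_value nu A.
Proof. by move=> mA; rewrite sm_valueD// sm_valueN. Qed.

Lemma sm_valueU mu A B : measurable A -> measurable B -> A `&` B = set0 ->
  sm_value mu (A `|` B) = sm_value mu A + sm_value mu B.
Proof.
by move=> mA mB AB; rewrite /sm_value chargeU// fineD// fin_num_measure.
Qed.

Lemma sm_value_ext mu nu :
  (forall A, measurable A -> sm_value mu A = sm_value nu A) -> mu = nu.
Proof.
by move=> e; apply: signed_measure_ext => A mA; rewrite !sm_valueE// e.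
Qed.

Lemma pos_coneP mu : pos_cone mu <->
  forall A, measurable A -> 0 <= sm_value mu A.
Proof.
by split=> mu0 A mA; have := mu0 A mA; rewrite sm_valueE// lee_fin.
Qed.

Lemma sm_value_norm mu A : measurable A -> `|sm_value mu A| <= `|mu|.
Proof.
move=> mA; rewrite signed_measure_normE ler_norml; apply/andP; split.
  have := tv_norm_ge mu measurable0 mA (set0I _).
  by rewrite charge0 /= -/(sm_value mu A); lra.
have := tv_norm_ge mu mA measurable0 (setI0 _).
by rewrite charge0 /= -/(sm_value mu A); lra.
Qed.

Lemma norm_le_sm_value mu (e : R) :
  (forall A, measurable A -> `|sm_value mu A| <= e) -> `|mu| <= 2 * e.
Proof.
move=> mue; have [[mP _] [mN _] _ _] := hahnP mu.
rewrite signed_measure_normE tv_normE -/(sm_value _ _) -/(sm_value mu (hahn_neg mu)).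
by have := mue _ mP; have := mue _ mN; rewrite !ler_norml => /andP[? ?] /andP[? ?]; lra.
Qed.

Lemma pos_cone_norm mu : pos_cone mu -> Psi mu = `|mu|.
Proof.
move=> /pos_coneP mu0; have [[mP _] [mN /(_ _ mN (@subset_refl _ _)) negN] PN PN0] := hahnP mu.
rewrite signed_measure_normE tv_normE /Psi -PN -/(sm_value _ _).
rewrite sm_valueU// -/(sm_value _ _) -/(sm_value mu (hahn_neg mu)).
move: negN; rewrite sm_valueE// lee_fin; have := mu0 _ mN; lra.
Qed.

Lemma pos_coneD mu nu : pos_cone mu -> pos_cone nu -> pos_cone (mu + nu).
Proof.
move=> /pos_coneP mu0 /pos_coneP nu0; apply/pos_coneP => A mA.
by rewrite sm_valueD// addr_ge0// ?mu0 ?nu0.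
Qed.

Lemma pos_coneZ a mu : 0 <= a -> pos_cone mu -> pos_cone (a *: mu).
Proof.
move=> a0 /pos_coneP mu0; apply/pos_coneP => A mA.
by rewrite sm_valueZ// mulr_ge0// mu0.
Qed.

Lemma pos_cone_closed : closed (@pos_cone d T R).
Proof.
move=> mu clmu; apply/pos_coneP => A mA; apply/ler_addgt0Pr => e e0.
have [nu [/pos_coneP/(_ _ mA) nu0]] := clmu _ (nbhsx_ballx mu e e0).
rewrite -ball_normE /= => munu.
have := sm_value_norm (mu - nu) mA; rewrite sm_valueB// ler_norml => /andP[h _].
lra.
Qed.

Let restr_out mu (D : set T) (mD : measurable D) A :
  ~ measurable A -> crestr0 mu mD A = 0%E.
Proof. by move=> nA; rewrite /crestr0 memNset. Qed.

Definition sm_restr mu (D : set T) (mD : measurable D) : signed_measure T R :=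
  SignedMeasure (restr_out mu mD).

Lemma sm_restrE mu (D : set T) (mD : measurable D) A : measurable A ->
  sm_value (sm_restr mu mD) A = sm_value mu (A `&` D).
Proof. by move=> mA; rewrite /sm_value /= /crestr0 mem_set. Qed.

(** The restrictions to the two Hahn sets; the norm is additive because it is computed on these very
    sets. *)
Lemma jordan_decomposition mu : exists p q,
  [/\ pos_cone p, pos_cone q, mu = p - q & `|mu| = `|p| + `|q| ].
Proof.
have [[mP posP] [mN negN] PN PN0] := hahnP mu.
pose p := sm_restr mu mP; pose q := - sm_restr mu mN.
have Pp : pos_cone p.
  apply/pos_coneP => A mA; rewrite sm_restrE// fine_ge0// posP//.
  exact: measurableI.
have Pq : pos_cone q.
  apply/pos_coneP => A mA; rewrite sm_valueN// sm_restrE// oppr_ge0.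
  by rewrite fine_le0// negN//; exact: measurableI.
exists p, q; split=> //.
  apply: sm_value_ext => A mA; rewrite opprK sm_valueD// !sm_restrE//.
  rewrite -sm_valueU; [|exact: measurableI|exact: measurableI|].
    by rewrite -setIUr PN setIT.
  by rewrite setIACA PN0 setI0.
rewrite -(pos_cone_norm Pp) -(pos_cone_norm Pq) signed_measure_normE tv_normE /Psi.
by rewrite -!/(sm_value _ _) sm_valueN// !sm_restrE// !setTI.
Qed.

Lemma Psi_linear a mu nu : Psi (a *: mu + nu) = a * Psi mu + Psi nu.
Proof. by rewrite /Psi -!/(sm_value _ _) sm_valueD// sm_valueZ. Qed.

Lemma pos_cone_al : al_cone (@pos_cone d T R) (@Psi d T R).
Proof.
split.
- exact: pos_cone_closed.
- by apply/pos_coneP.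
- exact: pos_coneD.
- exact: pos_coneZ.
- exact: Psi_linear.
- exact: pos_cone_norm.
- exact: jordan_decomposition.
Qed.

(** * Completeness for the total variation norm *)

Section completeness.
Variable F : set_system (signed_measure T R).
Hypotheses (FF : ProperFilter F) (cF : cauchy F).

Let near_center e : 0 < e -> exists mu, F [set nu | `|mu - nu| < e].
Proof.
move=> e0; have [mu Fmu] := (cauchyP F).1 cF e e0.
by exists mu; move: Fmu; rewrite -ball_normE.
Qed.

(** The setwise limit, set to 0 off the sigma-algebra as [charge_of_out] demands. *)
Let l A : R := if pselect (measurable A) is left _ then
  lim (sm_value mu A @[mu --> F]) else 0.

(** The measure [mu] is chosen before [A]: this uniformity is what passes countable additivity to
    the limit. The auxiliary [nu] may depend on [A], hence the factor 2. *)
Let l_near e : 0 < e -> exists mu, F [set nu | `|mu - nu| < e] /\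
  forall A, measurable A -> `|sm_value mu A - l A| <= 2 * e.
Proof.
move=> e0; have [mu Fmu] := near_center e0; exists mu; split=> // A mA.
have /cauchy_cvgP vcvg : cauchy (sm_value nu A @[nu --> F]).
  apply: cauchy_exP => e' e'0; have [nu Fnu] := near_center e'0.
  exists (sm_value nu A).
  have : F [set xi | `|sm_value nu A - sm_value xi A| < e'].
    apply: filterS Fnu => xi /= nuxi; rewrite -sm_valueB//.
    exact: le_lt_trans (sm_value_norm _ mA) nuxi.
  by rewrite -ball_normE.
have {vcvg} : sm_value nu A @[nu --> F] --> l A by rewrite /l; case: pselect.
move=> /cvgrPdist_lt/(_ e e0) Fl.
have [nu [nul munu]] := filter_ex (filterI Fl Fmu).
have := sm_value_norm (mu - nu) mA; rewrite sm_valueB//.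
have := ler_distD (sm_value nu A) (sm_value mu A) (l A).
by move: nul munu => /=; rewrite [`|l A - _|]distrC; lra.
Qed.

Let l_set0 : l set0 = 0.
Proof.
apply/eqP; rewrite -normr_le0; apply/ler_addgt0Pr => e e0.
have [|mu [_ /(_ _ measurable0)]] := @l_near (e / 2); first lra.
by rewrite sm_value_set0 sub0r normrN; lra.
Qed.

Let lU A B : measurable A -> measurable B -> A `&` B = set0 ->
  l (A `|` B) = l A + l B.
Proof.
move=> mA mB AB; apply/eqP; rewrite -subr_eq0 -normr_le0.
apply/ler_addgt0Pr => e e0; have [|mu [_ mul]] := @l_near (e / 6); first lra.
have := mul _ (measurableU _ _ mA mB); have := mul _ mA; have := mul _ mB.
rewrite sm_valueU// !ler_norml => /andP[? ?] /andP[? ?] /andP[? ?].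
by apply/andP; split; lra.
Qed.

Let big_additive (f : set T -> R) (S : nat -> set T) n : f set0 = 0 ->
  (forall A B, measurable A -> measurable B -> A `&` B = set0 ->
    f (A `|` B) = f A + f B) ->
  (forall i, measurable (S i)) -> trivIset setT S ->
  \sum_(0 <= i < n) f (S i) = f (\big[setU/set0]_(i < n) S i).
Proof.
move=> f0 fU mS tS; elim: n => [|n IH]; first by rewrite big_geq// big_ord0.
rewrite big_nat_recr//= IH big_ord_recr/= fU//; first exact: bigsetU_measurable.
by apply: (@trivIset_bigsetUI _ predT) => // i j _ _; exact: tS.
Qed.

Let L A := (l A)%:E.
Let L0 : L set0 = 0%E. Proof. by rewrite /L l_set0. Qed.
Let L_fin A : measurable A -> L A \is a fin_num. Proof. by []. Qed.
Let L_sigma : semi_sigma_additive L.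
Proof.
move=> S mS tS mU; rewrite /L; under eq_fun do rewrite sumEFin.
apply/cvg_EFin; first by apply: nearW.
apply/(@cvgn_normP R R^o) => e e0.
have [|mu [_ mul]] := @l_near (e / 8); first lra.
have := charge_semi_sigma_additive (s := mu) S mS tS mU.
rewrite (@sm_valueE mu) => // /fine_cvg /(@cvgn_normP R R^o)/(_ (e / 4)).
move=> [|N NP]; first lra.
exists N => n /NP; rewrite /comp.
rewrite (eq_bigr (fun i => (sm_value mu (S i))%:E)) => [|i _]; last exact: sm_valueE.
rewrite sumEFin /= (big_additive _ (sm_value_set0 mu) (@sm_valueU mu))//.
rewrite (big_additive _ l_set0 lU)//.
have mw : measurable (\big[setU/set0]_(i < n) S i) by exact: bigsetU_measurable.
have := mul _ mU; have := mul _ mw.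
rewrite !ler_norml => /andP[? ?] /andP[? ?] /andP[? ?].
by apply/andP; split; lra.
Qed.


HB.instance Definition _ := isCharge.Build _ _ _ L L0 L_fin L_sigma.

Let L_out A : ~ measurable A -> L A = 0%E.
Proof. by rewrite /L /l; case: pselect. Qed.

Lemma signed_measure_cauchy_cvg : cvg F.
Proof.
pose lim : signed_measure T R := SignedMeasure L_out.
apply: (cvgP lim); apply/cvgrPdist_le => e e0.
have [|mu [Fmu mul]] := @l_near (e / 8); first lra.
apply: filterS Fmu => nu /= munu.
rewrite (le_trans (ler_distD mu _ _))//.
have := @norm_le_sm_value (mu - lim) (e / 4); rewrite distrC.
suff h A : measurable A -> `|sm_value (mu - lim) A| <= e / 4 by move=> /(_ h); lra.
by move=> mA; rewrite sm_valueB// -/(l A); have := mul A mA; lra.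
Qed.

End completeness.
End signed_measure_values.

HB.instance Definition _ d (T : measurableType d) (R : realType) :=
  Uniform_isComplete.Build (signed_measure T R) (@signed_measure_cauchy_cvg d T R).

(** * Total variation *)

Section total_variation.
Context {d} {T : measurableType d} {R : realType}.
Implicit Types (mu nu rho m : signed_measure T R) (A D : set T).

Let variation_out mu A : ~ measurable A -> charge_variation (hahnP mu) A = 0%E.
Proof.
move=> nA; rewrite /charge_variation jordan_posE cjordan_posE jordan_negE.
by rewrite cjordan_negE /crestr0 memNset// oppe0 adde0.
Qed.

(** The variation as a vector of the space, so that it can be added, scaled and compared with other
    vectors. *)
Definition sm_abs mu : signed_measure T R := SignedMeasure (@variation_out mu).

(** Restriction to a set without a measurability proof as argument, so that it can be used under
    quantifiers over sets. *)
Definition sm_cut mu D : signed_measure T R :=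
  if pselect (measurable D) is left mD then sm_restr mu mD else 0.

Lemma sm_cutE mu D A : measurable D -> measurable A ->
  sm_value (sm_cut mu D) A = sm_value mu (A `&` D).
Proof. by move=> mD mA; rewrite /sm_cut; case: pselect => // mD'; rewrite sm_restrE. Qed.

Lemma variationE mu A : Defs.variation mu A = sm_abs mu A. Proof. by []. Qed.

Lemma sm_absE mu A : measurable A -> sm_value (sm_abs mu) A =
  sm_value mu (A `&` hahn_pos mu) - sm_value mu (A `&` hahn_neg mu).
Proof.
move=> mA; have [[mP _] [mN _] _ _] := hahnP mu.
rewrite /sm_value /= /charge_variation jordan_posE cjordan_posE jordan_negE.
rewrite cjordan_negE /crestr0 mem_set// /crestr /= fineD ?fineN//.
- by rewrite fin_num_measure//; exact: measurableI.
- by rewrite fin_numN fin_num_measure//; exact: measurableI.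
Qed.

Lemma sm_value_mono rho A B : pos_cone rho -> measurable A -> measurable B ->
  A `<=` B -> sm_value rho A <= sm_value rho B.
Proof.
move=> /pos_coneP rho0 mA mB AB; rewrite -(setDUK AB) sm_valueU//.
- by rewrite lerDl rho0//; exact: measurableD.
- exact: measurableD.
- by rewrite setDE setICA setICr setI0.
Qed.

Lemma sm_valueU_le rho A B : pos_cone rho -> measurable A -> measurable B ->
  sm_value rho (A `|` B) <= sm_value rho A + sm_value rho B.
Proof.
move=> rho0 mA mB; have -> : A `|` B = A `|` (B `\` A).
  apply/seteqP; split=> x /=; last by case=> [|[]]; [left|right].
  by have [Ax _|nAx [//|Bx]] := pselect (A x); [left|right].
have mBA : measurable (B `\` A) by exact: measurableD.
rewrite sm_valueU//; last by rewrite setDE setICA setICr setI0.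
by rewrite lerD2l sm_value_mono// => x [].
Qed.

Lemma sm_value_le_abs mu A : measurable A ->
  `|sm_value mu A| <= sm_value (sm_abs mu) A.
Proof.
move=> mA; rewrite -lee_fin -!sm_valueE//.
have := abse_charge_variation (hahnP mu) mA.
by rewrite sm_valueE// abse_EFin.
Qed.

Lemma sm_abs_pos mu : pos_cone (sm_abs mu).
Proof.
by apply/pos_coneP => A mA; apply: le_trans (sm_value_le_abs mu mA).
Qed.

(** The variation is the least majorant: its value on [A] is a difference of values of [mu] on the
    two Hahn pieces of [A], each bounded by [rho]. *)
Lemma sm_abs_min mu rho : (forall A, measurable A -> `|sm_value mu A| <= sm_value rho A) ->
  pos_cone (rho - sm_abs mu).
Proof.
move=> h; apply/pos_coneP => A mA; have [[mP _] [mN _] PN PN0] := hahnP mu.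
have mAP : measurable (A `&` hahn_pos mu) by exact: measurableI.
have mAN : measurable (A `&` hahn_neg mu) by exact: measurableI.
rewrite sm_valueB// subr_ge0 sm_absE// -[in leRHS](setIT A) -PN setIUr sm_valueU//.
  have := h _ mAP; have := h _ mAN; rewrite !ler_norml => /andP[? ?] /andP[? ?]; lra.
by rewrite setIACA PN0 setI0.
Qed.

Lemma sm_abs_le mu rho A : measurable A ->
  (forall A, measurable A -> `|sm_value mu A| <= sm_value rho A) ->
  sm_value (sm_abs mu) A <= sm_value rho A.
Proof.
by move=> mA /sm_abs_min/pos_coneP/(_ A mA); rewrite sm_valueB// subr_ge0.
Qed.

Lemma sm_abs_id rho : pos_cone rho -> sm_abs rho = rho.
Proof.
move=> rho0; apply: sm_value_ext => A mA; apply/eqP; rewrite eq_le.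
rewrite (le_trans (ler_norm _) (sm_value_le_abs rho mA)) andbT.
apply: sm_abs_le => // B mB; rewrite ger0_norm//.
by have /pos_coneP := rho0; exact.
Qed.

Lemma sm_abs_norm mu : sm_value (sm_abs mu) [set: T] = `|mu|.
Proof. by []. Qed.

Lemma sm_absD mu nu A : measurable A ->
  sm_value (sm_abs (mu + nu)) A <= sm_value (sm_abs mu) A + sm_value (sm_abs nu) A.
Proof.
move=> mA; rewrite -sm_valueD//; apply: sm_abs_le => // B mB.
by rewrite !sm_valueD// (le_trans (ler_normD _ _))// lerD// sm_value_le_abs.
Qed.

Lemma sm_absZ a mu A : measurable A ->
  sm_value (sm_abs (a *: mu)) A <= `|a| * sm_value (sm_abs mu) A.
Proof.
move=> mA; rewrite -sm_valueZ//; apply: sm_abs_le => // B mB.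
by rewrite !sm_valueZ// normrM ler_wpM2l// sm_value_le_abs.
Qed.

Lemma sm_abs_dist mu nu : `|sm_abs mu - sm_abs nu| <= `|mu - nu|.
Proof.
rewrite -!sm_abs_norm; apply: sm_abs_le => // A mA; rewrite sm_valueB//.
have := sm_absD (mu - nu) nu mA; have := sm_absD (nu - mu) mu mA.
rewrite !subrK => h1 h2.
have : sm_value (sm_abs (nu - mu)) A <= sm_value (sm_abs (mu - nu)) A.
  by rewrite -opprB -scaleN1r (le_trans (sm_absZ _ _ mA))// normrN1 mul1r.
by rewrite ler_norml => h3; apply/andP; split; lra.
Qed.

Lemma abs_contP nu mu : abs_cont nu mu <->
  forall A, measurable A -> sm_value (sm_abs mu) A = 0 -> sm_value (sm_abs nu) A = 0.
Proof.
have H := null_charge_dominatesP (hahnP nu) (Defs.variation mu).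
split=> [/H ac A mA A0|ac].
  apply: EFin_inj; rewrite -sm_valueE//; apply: (ac A mA).
  by have := sm_valueE (sm_abs mu) mA; rewrite A0.
apply/H => A mA muA; have := sm_valueE (sm_abs nu) mA; rewrite ac//.
by apply: EFin_inj; rewrite -sm_valueE.
Qed.

Lemma sm_value_bigcup_near rho (S : nat -> set T) (e : R) : pos_cone rho ->
  (forall n, measurable (S n)) -> 0 < e -> exists n,
  sm_value rho (\bigcup_n S n) <= sm_value rho (\big[setU/set0]_(i < n) S i) + e.
Proof.
move=> rho0 mS e0; have mU : measurable (\bigcup_n S n) by exact: bigcupT_measurable.
have mB n : measurable (\big[setU/set0]_(i < n) S i) by exact: bigsetU_measurable.
pose F n := \big[setU/set0]_(i < n.+1) S i.
have FU : \bigcup_n F n = \bigcup_n S n by exact: bigcup_bigsetU_bigcup.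
have ndF : nondecreasing_seq F.
  by move=> m n mn; apply/subsetPset; exact: subset_bigsetU.
have mFU : measurable (\bigcup_n F n) by rewrite FU.
have := @nondecreasing_cvg_mu _ _ _ (Defs.variation rho) F (fun n => mB n.+1) mFU ndF.
have vE A : Defs.variation rho A = rho A by rewrite variationE sm_abs_id.
rewrite FU vE sm_valueE// => /fine_cvg/(@cvgn_normP R R^o)/(_ e e0)[N].
move=> /(_ N (leqnn _)); rewrite /comp vE -/(sm_value rho _) ler_norml.
by move=> /andP[_ h]; exists N.+1; rewrite -/(F N); lra.
Qed.

Lemma sm_value_bigcup_null rho (S : nat -> set T) : pos_cone rho ->
  (forall n, measurable (S n)) -> (forall n, sm_value rho (S n) = 0) ->
  sm_value rho (\bigcup_n S n) = 0.
Proof.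
move=> rho0 mS S0; apply/eqP; rewrite eq_le; apply/andP; split; last first.
  by have /pos_coneP := rho0; apply; exact: bigcupT_measurable.
apply/ler_addgt0Pr => e e0; have [n h] := sm_value_bigcup_near rho0 mS e0.
apply: (le_trans h); rewrite lerD2r; elim: n {h} => [|n IH].
  by rewrite big_ord0 sm_value_set0.
rewrite big_ord_recr/= (le_trans (sm_valueU_le rho0 _ _))//.
  exact: bigsetU_measurable.
by rewrite S0 addr0.
Qed.

(* The sets come from Hahn decompositions of [n *: m - rho]. *)
Lemma domination_sets rho m : pos_cone rho -> pos_cone m ->
  exists S : nat -> set T, [/\ forall n, measurable (S n),
    forall n A, measurable A -> A `<=` S n -> sm_value rho A <= n%:R * sm_value m A &
    sm_value m (~` \bigcup_n S n) = 0].
Proof.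
move=> rho0 m0; pose S n := hahn_pos (n%:R *: m - rho).
have mS n : measurable (S n) by have [[]] := hahnP (n%:R *: m - rho).
exists S; split=> // [n A mA AS|].
  have [[_ posS] _ _ _] := hahnP (n%:R *: m - rho).
  have := posS A mA AS; rewrite sm_valueE// lee_fin sm_valueB// sm_valueZ//.
  by rewrite subr_ge0.
set Z := ~` _; have mZ : measurable Z by apply: measurableC; exact: bigcupT_measurable.
have mZ0 : 0 <= sm_value m Z by have /pos_coneP := m0; exact.
(* [Z] lies in the negative Hahn set for every [n], and a positive [m]-mass would contradict the
   Archimedean property. *)
have nZ n : n%:R * sm_value m Z <= sm_value rho Z.
  have [_ [_ negN] PN _] := hahnP (n%:R *: m - rho).
  have ZN : Z `<=` hahn_neg (n%:R *: m - rho).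
    move=> x Zx; have : [set: T] x by [].
    by rewrite -PN => -[Sx|//]; exfalso; apply: Zx; exists n.
  have := negN Z mZ ZN; rewrite sm_valueE// lee_fin sm_valueB// sm_valueZ//.
  by rewrite subr_le0.
apply/eqP; rewrite eq_le mZ0 andbT leNgt; apply/negP => Zgt.
have := nZ (Num.trunc (sm_value rho Z / sm_value m Z)).+1.
rewrite -ler_pdivlMr// leNgt => /negP; apply.
apply: truncnS_gt.
Qed.

End total_variation.

(** * Bands generated by hereditary cones *)

Section hereditary_cones.
Context {d} {T : measurableType d} {R : realType}.
Local Notation X := (signed_measure T R).
Implicit Types (mu nu rho m : X) (A D E : set T).
Variable C : set X.
Hypothesis C_pos : C `<=` pos_cone (R := R).
Hypothesis C_closed : closed C.
Hypothesis C0 : C 0.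
Hypothesis CD : forall mu nu, C mu -> C nu -> C (mu + nu).
Hypothesis CZ : forall a mu, 0 <= a -> C mu -> C (a *: mu).
Hypothesis C_hereditary : forall mu nu, C nu -> pos_cone mu -> pos_cone (nu - mu) -> C mu.

Let C_le mu nu : C nu -> pos_cone mu ->
  (forall A, measurable A -> sm_value mu A <= sm_value nu A) -> C mu.
Proof.
move=> Cnu mu0 h; apply: (C_hereditary Cnu) => //; apply/pos_coneP => A mA.
by rewrite sm_valueB// subr_ge0 h.
Qed.

Let C_approx mu : (forall e, 0 < e -> exists2 nu, C nu & `|mu - nu| <= e) -> C mu.
Proof.
move=> h; apply: C_closed => U /nbhs_ballP[e /= e0 eU].
have [|nu Cnu munu] := h (e / 2); first lra.
by exists nu; split=> //; apply: eU; rewrite -ball_normE /=; lra.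
Qed.

Let ideal : set X := [set u - w | u in C & w in C].

(** If [mu] is [u - w], its variation is at most [u + w]. Conversely the positive and negative
    parts, half of [sm_abs mu] plus or minus [mu], are dominated by [sm_abs mu]. Everything about
    the span thereby becomes an inequality in [C]. *)
Let idealP mu : ideal mu <-> C (sm_abs mu).
Proof.
split=> [[u Cu [w Cw <-]]|Cmu].
  apply: (C_le (CD Cu Cw) (sm_abs_pos _)) => A mA; apply: sm_abs_le => // B mB.
  have /pos_coneP/(_ B mB) := C_pos Cu; have /pos_coneP/(_ B mB) := C_pos Cw.
  by rewrite sm_valueB// sm_valueD// ler_norml => ? ?; apply/andP; split; lra.
have half (s : R) : (s = 1 \/ s = -1) -> C ((1 / 2) *: (sm_abs mu + s *: mu)).
  move=> s1; apply: (C_le Cmu); last first.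
    move=> A mA; rewrite sm_valueZ// sm_valueD// sm_valueZ//.
    have := sm_value_le_abs mu mA; rewrite ler_norml => /andP[? ?].
    by case: s1 => ->; lra.
  apply: pos_coneZ; first lra.
  apply/pos_coneP => A mA; rewrite sm_valueD// sm_valueZ//.
  have := sm_value_le_abs mu mA; rewrite ler_norml => /andP[? ?].
  by case: s1 => ->; lra.
exists ((1 / 2) *: (sm_abs mu + 1 *: mu)); first by apply: half; left.
exists ((1 / 2) *: (sm_abs mu + (-1) *: mu)); first by apply: half; right.
by module_eq R; field.
Qed.

Let ideal_linear : linear_subspace ideal.
Proof.
split; first by apply/idealP; rewrite sm_abs_id//; exact: C_pos.
move=> a mu nu /idealP Cmu /idealP Cnu; apply/idealP.
apply: (C_le (CD (CZ (normr_ge0 a) Cmu) Cnu) (sm_abs_pos _)) => A mA.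
rewrite (le_trans (sm_absD _ _ mA))// sm_valueD// sm_valueZ// lerD2r.
exact: sm_absZ.
Qed.

Let ideal_closed : closed ideal.
Proof.
move=> mu clmu; apply/idealP; apply: C_approx => e e0.
have [nu [/idealP Cnu]] := clmu _ (nbhsx_ballx mu e e0).
rewrite -ball_normE /= => munu; exists (sm_abs nu) => //.
by rewrite (le_trans (sm_abs_dist _ _))// ltW.
Qed.

Let cut_pos rho D : pos_cone rho -> measurable D -> pos_cone (sm_cut rho D).
Proof.
move=> /pos_coneP rho0 mD; apply/pos_coneP => A mA.
by rewrite sm_cutE// rho0//; exact: measurableI.
Qed.

(** Finite unions follow from subadditivity and heredity; the countable union is their limit in
    norm, and [C] is closed. *)
Let cut_bigcup rho (S : nat -> set T) : pos_cone rho ->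
  (forall n, measurable (S n)) -> (forall n, C (sm_cut rho (S n))) ->
  C (sm_cut rho (\bigcup_n S n)).
Proof.
move=> rho0 mS CS; have mU : measurable (\bigcup_n S n) by exact: bigcupT_measurable.
pose B n := \big[setU/set0]_(i < n) S i.
have mB n : measurable (B n) by exact: bigsetU_measurable.
have BU n : B n `<=` \bigcup_n S n by rewrite /B -bigcup_mkord => x [i _ Six]; exists i.
have CB n : C (sm_cut rho (B n)).
  elim: n => [|n IH].
    apply: (C_le C0); first exact: cut_pos.
    by move=> A mA; rewrite sm_cutE// /B big_ord0 setI0 sm_value_set0.
  apply: (C_le (CD IH (CS n))); first exact: cut_pos.
  move=> A mA; rewrite sm_valueD// !sm_cutE// /B big_ord_recr/= -/(B n) setIUr.
  by apply: sm_valueU_le => //; exact: measurableI.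
apply: C_approx => e e0; have [n nB] := sm_value_bigcup_near rho0 mS e0.
exists (sm_cut rho (B n)) => //; rewrite -pos_cone_norm.
  rewrite /Psi -/(sm_value _ _) sm_valueB// !sm_cutE// !setTI.
  by rewrite lerBlDl.
apply/pos_coneP => A mA; rewrite sm_valueB// !sm_cutE// subr_ge0.
apply: sm_value_mono => //; [exact: measurableI|exact: measurableI|].
exact: setIS.
Qed.

(** On [S n] the variation of [nu] is at most [n] times that of [mu], so its cuts lie in [C]; off
    their union [mu], and hence [nu], is null. *)
Let ideal_abs_cont mu nu : ideal mu -> abs_cont nu mu -> ideal nu.
Proof.
move=> /idealP Cmu /abs_contP numu; apply/idealP.
have [S [mS leS S0]] := domination_sets (sm_abs_pos nu) (sm_abs_pos mu).
have mU : measurable (\bigcup_n S n) by exact: bigcupT_measurable.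
have CU : C (sm_cut (sm_abs nu) (\bigcup_n S n)).
  apply: cut_bigcup => [|//|n]; first exact: sm_abs_pos.
  apply: (C_le (CZ (ler0n R n) Cmu)); first by apply: cut_pos => //; exact: sm_abs_pos.
  move=> A mA; rewrite sm_cutE// sm_valueZ//.
  have mAS : measurable (A `&` S n) by exact: measurableI.
  apply: (le_trans (leS n _ mAS (@subIsetr _ _ _))).
  by rewrite ler_wpM2l// sm_value_mono.
have Z0 := numu _ (measurableC mU) S0.
apply: (C_le CU (sm_abs_pos nu)) => A mA; rewrite sm_cutE//.
have mAU : measurable (A `&` \bigcup_n S n) by exact: measurableI.
have mAZ : measurable (A `&` ~` \bigcup_n S n).
  by apply: measurableI => //; exact: measurableC.
rewrite -[in leLHS](setIT A) -(setUv (\bigcup_n S n)) setIUr.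
rewrite (le_trans (sm_valueU_le (sm_abs_pos nu) mAU mAZ))// gerDl -Z0.
by apply: sm_value_mono => //; exact: measurableC.
Qed.

Theorem hereditary_cone_M_ideal : M_ideal [set u - w | u in C & w in C].
Proof. by split; [split|exact: ideal_abs_cont]. Qed.

(** Disjointness means singularity to each [rho] in [C], with a separating set that may depend on
    [rho]. Intersecting such sets then gives linearity and closedness. In the forward direction, the
    cut of [rho] to the domination sets is absolutely continuous with respect to [mu] and lies below
    [rho], hence vanishes. *)
Let complementP mu : disjoint_complement ideal mu <->
  forall rho, C rho -> exists Z, [/\ measurable Z,
    sm_value (sm_abs mu) Z = 0 & sm_value rho (~` Z) = 0].
Proof.
split=> [dmu rho Crho|h nu /abs_contP numu /idealP Cnu].
  have rho0 := C_pos Crho.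
  have [S [mS leS S0]] := domination_sets rho0 (sm_abs_pos mu).
  have mU : measurable (\bigcup_n S n) by exact: bigcupT_measurable.
  exists (~` \bigcup_n S n); split=> //; first exact: measurableC.
  rewrite setCK; have cut0 := cut_pos rho0 mU.
  suff : sm_cut rho (\bigcup_n S n) = 0.
    move=> e; have := sm_cutE rho mU measurableT; rewrite setTI => <-.
    by rewrite e.
  apply: dmu.
    apply/abs_contP => A mA muA; rewrite (sm_abs_id cut0) sm_cutE// setI_bigcupr.
    have mAS n : measurable (A `&` S n) by exact: measurableI.
    apply: sm_value_bigcup_null => // n; apply/eqP; rewrite eq_le.
    have /pos_coneP/(_ _ (mAS n)) -> := rho0; rewrite andbT.
    rewrite (le_trans (leS n _ (mAS n) (@subIsetr _ _ _)))//.
    rewrite -[leRHS](mulr0 n%:R) -muA ler_wpM2l// sm_value_mono//.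
  apply/idealP; rewrite (sm_abs_id cut0); apply: (C_le Crho cut0) => A mA.
  by rewrite sm_cutE// sm_value_mono//; exact: measurableI.
have [Z [mZ muZ nuZ]] := h _ Cnu.
apply/eqP; rewrite -normr_le0 -sm_abs_norm -(setUv Z).
rewrite (le_trans (sm_valueU_le (sm_abs_pos nu) mZ (measurableC mZ)))//.
by rewrite nuZ numu// addr0.
Qed.

Let complement_linear : linear_subspace (disjoint_complement ideal).
Proof.
split.
  apply/complementP => rho Crho; exists setT; split=> //.
    by rewrite sm_abs_id//; exact: C_pos.
  by rewrite setCT sm_value_set0.
move=> a mu nu /complementP hmu /complementP hnu; apply/complementP => rho Crho.
have rho0 := C_pos Crho.
have [Z [mZ muZ rZ]] := hmu _ Crho; have [Y [mY nuY rY]] := hnu _ Crho.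
have mI : measurable (Z `&` Y) by exact: measurableI.
exists (Z `&` Y); split=> //; apply/eqP; rewrite eq_le; apply/andP; split.
- rewrite (le_trans (sm_absD _ _ mI))//.
  have := sm_absZ a mu mI.
  have hm : sm_value (sm_abs mu) (Z `&` Y) <= 0.
    by rewrite -muZ sm_value_mono.
  have hn : sm_value (sm_abs nu) (Z `&` Y) <= 0.
    by rewrite -nuY sm_value_mono.
  have := mulr_ge0_le0 (normr_ge0 a) hm; lra.
- by have /pos_coneP := sm_abs_pos (a *: mu + nu); exact.
- rewrite setCI (le_trans (sm_valueU_le rho0 _ _)) ?rZ ?rY ?addr0//; exact: measurableC.
- by have /pos_coneP := rho0; apply; exact: measurableC.
Qed.

Let complement_closed : closed (disjoint_complement ideal).
Proof.
move=> mu clmu; apply/complementP => rho Crho; have rho0 := C_pos Crho.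
(* A separating set for an element of the complement at distance below [2 ^- n] is almost null for
   [mu]; the intersection over [n] is null. *)
have near n : exists Z, [/\ measurable Z, sm_value (sm_abs mu) Z <= 2 ^- n &
    sm_value rho (~` Z) = 0].
  have [nu [/complementP/(_ _ Crho)[Z [mZ nuZ rZ]]]] :=
    clmu _ (nbhsx_ballx mu _ (dyadic_gt0 n)).
  rewrite -ball_normE /= => munu; exists Z; split=> //.
  have := sm_absD (mu - nu) nu mZ; rewrite subrK nuZ addr0.
  move=> /le_trans; apply; apply: le_trans (ltW munu); rewrite -sm_abs_norm.
  by apply: sm_value_mono => //; exact: measurableC.
have [Z ZP] := choice near.
have mZ n : measurable (Z n) by have [] := ZP n.
have mI : measurable (\bigcap_n Z n) by exact: bigcapT_measurable.
have mu0 := sm_abs_pos mu.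
exists (\bigcap_n Z n); split=> //.
  apply/eqP; rewrite eq_le; apply/andP; split; last by have /pos_coneP := mu0; exact.
  apply/ler_addgt0Pr => e /(@dyadic_small R)[n /(_ n (leqnn _)) ne].
  have [_ Zn _] := ZP n; rewrite add0r (le_trans _ ne)// (le_trans _ Zn)//.
  by apply: sm_value_mono => //; exact: bigcap_inf.
rewrite setC_bigcap; apply: sm_value_bigcup_null => // n; last by have [] := ZP n.
exact: measurableC.
Qed.

(** [E] maximizes the [rho]-mass among sets whose cut lies in [C]: by [cut_bigcup] the union of a
    maximizing sequence is again such a set. A disjoint competitor [D] of positive mass would let
    the union of [E] and [D] exceed the supremum. *)
Let exhaustion rho : pos_cone rho -> exists E, [/\ measurable E, C (sm_cut rho E) &
  forall D, measurable D -> C (sm_cut rho D) -> E `&` D = set0 -> sm_value rho D = 0].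
Proof.
move=> rho0; pose F := [set D | measurable D /\ C (sm_cut rho D)].
pose V := [set sm_value rho D | D in F].
have F0 : F set0.
  split=> //; apply: (C_le C0); first exact: cut_pos.
  by move=> A mA; rewrite sm_cutE// setI0 sm_value_set0.
have supV : has_sup V.
  split; first by exists (sm_value rho set0), set0.
  exists (sm_value rho setT) => _ [D [mD _] <-]; exact: sm_value_mono.
have near n : exists D, F D /\ sup V - 2 ^- n < sm_value rho D.
  by have [_ [D FD <-] ?] := sup_adherent (dyadic_gt0 n) supV; exists D.
have [S SP] := choice near.
have mS n : measurable (S n) by have [[]] := SP n.
have CS n : C (sm_cut rho (S n)) by have [[]] := SP n.
pose E := \bigcup_n S n; have mE : measurable E by exact: bigcupT_measurable.
have CE : C (sm_cut rho E) by exact: cut_bigcup.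
exists E; split=> // D mD CDcut ED.
have D0 : 0 <= sm_value rho D by have /pos_coneP := rho0; exact.
have : F (E `|` D).
  split; first exact: measurableU.
  apply: (C_le (CD CE CDcut)); first by apply: cut_pos => //; exact: measurableU.
  move=> A mA; rewrite sm_valueD// !sm_cutE//; last exact: measurableU.
  by rewrite setIUr sm_valueU_le//; exact: measurableI.
move=> FED; have := sup_ubound (proj2 supV) (ex_intro2 _ _ _ FED erefl).
rewrite sm_valueU// => EDsup.
apply/eqP; rewrite eq_le D0 andbT.
apply/ler_addgt0Pr => e /(@dyadic_small R)[n /(_ n (leqnn _)) ne].
have [_ Sn] := SP n.
have SE : sm_value rho (S n) <= sm_value rho E.
  by apply: sm_value_mono => // x Sx; exists n.
rewrite add0r; move: EDsup; rewrite /=; lra.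
Qed.

Theorem hereditary_cone_direct_sum :
  is_direct_sum ideal (disjoint_complement ideal).
Proof.
split; [by split|by split| |].
- apply/seteqP; split=> // mu _.
  have [E [mE CE maxE]] := exhaustion (sm_abs_pos mu).
  have mcE := measurableC mE.
  exists (sm_cut mu E).
    apply/idealP; apply: (C_le CE (sm_abs_pos _)) => A mA; apply: sm_abs_le => // B mB.
    by rewrite !sm_cutE// sm_value_le_abs//; exact: measurableI.
  exists (sm_cut mu (~` E)); last first.
    apply: sm_value_ext => A mA; rewrite sm_valueD// !sm_cutE//.
    rewrite -sm_valueU; [|exact: measurableI|exact: measurableI|].
      by rewrite -setIUr setUv setIT.
    by rewrite setIACA setICr setI0.
  apply/complementP => rho Crho; have rho0 := C_pos Crho.
  have m0 : pos_cone (sm_cut (sm_abs mu) (~` E)) by apply: cut_pos => //; exact: sm_abs_pos.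
  (* On [S n] the part of the variation of [mu] outside [E] is at most [n] times [rho], so its cut
     lies in [C] and maximality of [E] makes it null. Off the union of the [S n], [rho] is null. *)
  have [S [mS leS S0]] := domination_sets m0 rho0.
  have mU : measurable (\bigcup_n S n) by exact: bigcupT_measurable.
  exists (\bigcup_n S n); split=> //.
  apply: sm_value_bigcup_null => // n.
  have mSE : measurable (S n `&` ~` E) by exact: measurableI.
  apply/eqP; rewrite eq_le; have /pos_coneP/(_ _ (mS n)) -> := sm_abs_pos (sm_cut mu (~` E)).
  rewrite andbT (le_trans (@sm_abs_le _ _ _ (sm_cut mu (~` E)) (sm_cut (sm_abs mu) (~` E)) _ (mS n) _))//.
    by move=> A mA; rewrite !sm_cutE// sm_value_le_abs//; exact: measurableI.
  rewrite sm_cutE// maxE//; last by rewrite setICA setICr setI0.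
  apply: (C_le (CZ (ler0n R n) Crho)); first by apply: cut_pos => //; exact: sm_abs_pos.
  move=> A mA; rewrite sm_cutE// sm_valueZ//.
  have mAS : measurable (A `&` S n) by exact: measurableI.
  have := leS n _ mAS (@subIsetr _ _ _); rewrite sm_cutE// -setIA => /le_trans; apply.
  by rewrite ler_wpM2l// sm_value_mono//.
- apply/seteqP; split=> [mu [imu dmu]|_ ->].
    by apply: dmu => //; apply/abs_contP.
  by split; [exact: (proj1 ideal_linear)|exact: (proj1 complement_linear)].
Qed.

End hereditary_cones.

(** * Minimal semigroups *)

Section substochastic_semigroups.
Context {d} {T : measurableType d} {R : realType}.
Local Notation X := (signed_measure T R).
Implicit Types (S : R -> {linear X -> X}) (u w g : X).

Lemma substochastic_contraction S : substochastic S -> contraction_semigroup S.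
Proof.
move=> [[_ S0 SD Scvg] Spos S1]; split=> // t u t0.
have [p [q [Pp Pq -> ->]]] := jordan_decomposition u.
by rewrite linearB (le_trans (ler_normB _ _))// lerD// S1.
Qed.

Lemma generatorP S u g : generates S u g ->
  op_dom (generator S) u /\ generator S u = g.
Proof.
move=> ug; split; first exact: cvgP ug.
exact: (cvg_lim (@norm_hausdorff R X) ug).
Qed.

Lemma generator_domP S u : op_dom (generator S) u -> generates S u (generator S u).
Proof. by []. Qed.

(** The choice made by [get] is harmless because dissipativity makes the solution unique. *)
Lemma resolventE S l f : contraction_semigroup S -> 0 < l ->
  resolvent (generator S) l f = semigroup_resolvent S l f.
Proof.
move=> semiS l0; apply: get_unique.
  have g := semigroup_resolvent_generates semiS l0 f.
  have [Dx Gx] := generatorP g; split; first exact: Dx.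
  by rewrite -[RHS](subKr (l *: semigroup_resolvent S l f)); congr (_ - _).
move=> w [Dw <-]; rewrite semigroup_resolventK//; exact: generator_domP.
Qed.

Lemma semigroup_resolvent_pos S l f : substochastic S -> 0 < l ->
  pos_cone f -> pos_cone (semigroup_resolvent S l f).
Proof.
move=> subS l0 Pf; have [_ Spos _] := subS.
apply: (semigroup_resolvent_closed (substochastic_contraction subS) l0).
- exact: pos_cone_closed.
- by apply/pos_coneP.
- exact: pos_coneD.
- exact: pos_coneZ.
- by move=> t t0; exact: Spos.
Qed.

End substochastic_semigroups.

Section minimal_semigroups.
Context {d} {T : measurableType d} {R : realType}.
Local Notation X := (signed_measure T R).
Variables (U V : R -> {linear X -> X}) (B : X -> X).
Local Notation A := (generator U).
Local Notation G := (generator V).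
Hypothesis subU : substochastic U.
Hypothesis B_linear : linear_on (op_dom A) B.
Hypothesis B_pos : positive_on (op_dom A) B.
Hypothesis AB_le0 : forall u, op_dom A u -> pos_cone u -> Psi (A u + B u) <= 0.
Hypothesis minV : minimal_semigroup A B V.

Let semiU : contraction_semigroup U. Proof. exact: substochastic_contraction. Qed.
Let subV : substochastic V. Proof. by case: minV. Qed.
Let semiV : contraction_semigroup V. Proof. exact: substochastic_contraction. Qed.
Let alP : al_cone (@pos_cone d T R) (@Psi d T R). Proof. exact: pos_cone_al. Qed.

Let setting : kato_setting (@pos_cone d T R) (@Psi d T R) (op_dom A) A B
  (semigroup_resolvent U).
Proof.
split.
- move=> c x y /generator_domP Dx /generator_domP Dy.
  by have [] := generatorP (generates_linear c Dx Dy).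
- move=> c x y /generator_domP Dx /generator_domP Dy.
  by have [] := generatorP (generates_linear c Dx Dy).
- exact: B_linear.
- exact: B_pos.
- exact: AB_le0.
- move=> l f l0.
  by have [] := generatorP (semigroup_resolvent_generates semiU l0 f).
- move=> l f l0.
  have [_ ->] := generatorP (semigroup_resolvent_generates semiU l0 f).
  by rewrite subKr.
- by move=> l x l0 /generator_domP; exact: semigroup_resolventK.
- by move=> l f; exact: semigroup_resolvent_pos.
- by move=> u e; exact: semigroup_resolvent_strong_limit.
Qed.

Local Notation Q := (kato_resolvent alP setting).

Let G_extends u : op_dom A u -> generates V u (A u + B u).
Proof.
move=> Du; have [_ [DG /(_ u Du) /= GE] _] := minV.
by rewrite -GE; apply: generator_domP; exact: DG.
Qed.

(* The semigroup generated by the Kato resolvent is a competitor of [V]. *)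
Let kato_le l f : 0 < l -> pos_cone f -> pos_cone (Q l f - semigroup_resolvent V l f).
Proof.
move=> l0 Pf.
have [|||W [semiW genW posW]] := @hille_yosida R X Q.
- by move=> *; exact: kato_resolvent_bound.
- by move=> *; exact: kato_resolvent_eq.
- by move=> *; exact: kato_resolvent_near.
have [W0 WD W1 Wcvg] := semiW.
have Wpos t u : pos_cone u -> pos_cone (W t u).
  apply: (posW (@pos_cone d T R)) => [||l' x].
  - exact: pos_cone_closed.
  - exact: pos_coneZ.
  - exact: kato_resolvent_pos.
have subW : substochastic W.
  split=> [|t u _|t u t0 _]; [|exact: Wpos|exact: W1].
  by split=> // t t0; apply: contraction_continuous => u; exact: W1.
have extW : extends (generator W) (perturb A B).
  have gen u : op_dom A u -> generates W u (A u + B u).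
    (* [Q 1] sends this vector back to [u], so a single parameter reads off the generator of [W] at
       [u]. *)
    move=> Du; have := genW 1 (1 *: u - (A u + B u)) ltr01.
    by rewrite (kato_resolventK alP setting)// subKr.
  by split=> u /= /gen/generatorP[].
have [_ _ /(_ W subW extW) minW] := minV.
have -> : Q l f = semigroup_resolvent W l f.
  by rewrite -[in RHS](subKr (l *: Q l f) f) semigroup_resolventK//; exact: genW.
apply: semigroup_resolvent_le => //.
- exact: pos_cone_closed.
- exact: pos_coneD.
- exact: pos_coneZ.
- by move=> t t0; exact: minW.
Qed.

(** Stated in the graph of the generator, so that the positive case extends to all [f] by
    [generates_linear]. *)
Let kato_generates l f : 0 < l -> generates V (Q l f) (l *: Q l f - f).
Proof.
move=> l0; have pos_case p : pos_cone p -> generates V (Q l p) (l *: Q l p - p).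
  move=> Pp; suff <- : semigroup_resolvent V l p = Q l p.
    exact: semigroup_resolvent_generates.
  apply/eqP; rewrite -subr_eq0; apply/eqP; apply: (al_anti alP).
    pose s N := series (kato_term B (semigroup_resolvent U) l p) N.
    apply: (@cvgn_in_closed _ _ _ (fun N => semigroup_resolvent V l p - s N) _
      (@pos_cone_closed d T R)).
      by apply: cvgB; [exact: cvg_cst|exact: kato_resolvent_cvg].
    move=> N; set k := iter N (kato_step B (semigroup_resolvent U) l) p.
    have Ds : op_dom A (s N) by exact: (kato_series_dom setting).
    have sE : l *: s N - (A (s N) + B (s N)) = p - k.
      exact: (kato_series_eq setting p N l0).
    have gen := semigroup_resolvent_generates semiV l0 p.
    have := generates_linear (-1) (G_extends Ds) gen.
    rewrite !scaleN1r ![- _ + _]addrC => /semigroup_resolventK.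
    move=> /(_ l semiV l0) <-; apply: (semigroup_resolvent_pos subV l0).
    have -> : l *: (semigroup_resolvent V l p - s N) -
      (l *: semigroup_resolvent V l p - p - (A (s N) + B (s N))) =
      p - (l *: s N - (A (s N) + B (s N))) by module_eq R.
    by rewrite sE subKr; exact: (kato_iter_pos setting).
  by rewrite opprB; exact: kato_le.
have [p [q [Pp Pq -> _]]] := jordan_decomposition f.
have := generates_linear (-1) (pos_case q Pq) (pos_case p Pp).
by congr (generates V _ _); rewrite ?(linearB (Q l)); module_eq R.
Qed.

Let RG l f : 0 < l -> resolvent G l f = Q l f.
Proof.
move=> l0; rewrite (resolventE _ semiV)//.
by rewrite -[in LHS](subKr (l *: Q l f) f) semigroup_resolventK//; exact: kato_generates.
Qed.

Let RA_iter l u n : 0 < l -> iter n (fun v => B (resolvent A l v)) u =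
  iter n (kato_step B (semigroup_resolvent U) l) u.
Proof. by move=> l0; elim: n => //= n ->; rewrite (resolventE _ semiU). Qed.

Local Notation alpha :=
  (kato_alpha (psi := @Psi d T R) A B (semigroup_resolvent U)).

Let series_a0 l u : 0 < l -> series (fun n => functional_a0 G
    (resolvent A l (iter n (fun v => B (resolvent A l v)) u))) @ \oo -->
  alpha l u.
Proof.
move=> l0; rewrite (_ : (fun n => _) =
  kato_loss (psi := @Psi d T R) A B \o kato_term B (semigroup_resolvent U) l u).
  exact: (kato_alpha_cvg alP setting).
apply/funext => n.
rewrite RA_iter// (resolventE _ semiU)//=.
have [Dx _] := generatorP (semigroup_resolvent_generates semiU l0
  (iter n (kato_step B (semigroup_resolvent U) l) u)).
have [_ Gx] := generatorP (G_extends Dx).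
by rewrite /functional_a0 Gx.
Qed.

(** [functional_abar] selects a number that serves all representations of one vector at once, so its
    existence requires invariance in the parameter. *)
Let abarE l u : 0 < l -> functional_abar A B G (resolvent G l u) =
  alpha l u.
Proof.
move=> l0; apply: get_unique => [m v m0|r /(_ l u l0 erefl) sr]; last first.
  exact: (@cvgn_eq R R^o _ _ _ sr (series_a0 l0)).
rewrite !RG// => e; suff -> : alpha l u =
    alpha m v by exact: series_a0.
rewrite (kato_alpha_invariant alP setting _ l0 m0); congr kato_alpha.
(* With [w] the common image, [G w] is both [l *: w - u] and [m *: w - v], which determines [v] from
   [u] and [w]. *)
have [_ g1] := generatorP (kato_generates (f := u) l0).
have [_ g2] := generatorP (kato_generates (f := v) m0).
rewrite -e g1 in g2; rewrite -[v](subKr (m *: Q l u)) -g2.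
by module_eq R.
Qed.

Let XiE l u : 0 < l -> Xi A B G l u =
  kato_defect alP setting l u.
Proof.
move=> l0; rewrite /Xi abarE// RG// /functional_a0.
have [_ ->] := generatorP (kato_generates (f := u) l0).
by rewrite (al_psiB alP) (al_psiZ alP) opprB.
Qed.

Let defect_linear l (l0 : 0 < l) : forall (c : R) (x y : X), kato_defect alP setting l (c *: x + y) =
  c * kato_defect alP setting l x + kato_defect alP setting l y.
Proof. by move=> c x y; exact: kato_defect_linear. Qed.

Let defect_bound l (l0 : 0 < l) : forall x : X, pos_cone x ->
  0 <= kato_defect alP setting l x <= Psi x.
Proof. by move=> x; exact: kato_defect_bound. Qed.

Let H_coneP u : H_cone A B G u <->
  pos_cone u /\ forall l, 0 < l -> kato_defect alP setting l u = 0.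
Proof.
split=> -[Pu Xi0]; split=> // l l0; first by rewrite -XiE// Xi0.
by rewrite XiE// Xi0.
Qed.

Let H_cone_closed : closed (H_cone A B G).
Proof.
move=> u clu; apply/H_coneP; split.
  by apply: pos_cone_closed; apply: closure_subset clu => v [].
move=> l l0; apply/eqP; rewrite -normr_le0; apply/ler_addgt0Pr => e e0.
have [v [/H_coneP[_ v0]]] := clu _ (nbhsx_ballx u e e0).
rewrite -ball_normE /= => uv; rewrite add0r.
apply: le_trans (ltW uv).
have := al_functional_norm alP (defect_linear l0) (defect_bound l0) (u - v).
by rewrite (al_functionalB (defect_linear l0)) v0// subr0.
Qed.

Let H_coneD u w : H_cone A B G u -> H_cone A B G w -> H_cone A B G (u + w).
Proof.
move=> /H_coneP[Pu u0] /H_coneP[Pw w0]; apply/H_coneP; split.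
  exact: pos_coneD.
by move=> l l0; rewrite (al_functionalD (defect_linear l0)) u0// w0// addr0.
Qed.

Let H_coneZ a u : 0 <= a -> H_cone A B G u -> H_cone A B G (a *: u).
Proof.
move=> a0 /H_coneP[Pu u0]; apply/H_coneP; split; first exact: pos_coneZ.
by move=> l l0; rewrite (al_functionalZ (defect_linear l0)) u0// mulr0.
Qed.

(** The defect is monotone and nonnegative on the cone, so it vanishes below any of its zeros. *)
Let H_cone_hereditary u w : H_cone A B G w -> pos_cone u -> pos_cone (w - u) ->
  H_cone A B G u.
Proof.
move=> /H_coneP[Pw w0] Pu wu; apply/H_coneP; split; first exact: Pu.
move=> l l0; have /andP[du _] := defect_bound l0 Pu.
have := al_functional_le (defect_linear l0) (defect_bound l0) wu.
by rewrite (w0 l l0) => du'; apply/eqP; rewrite eq_le du du'.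
Qed.

Let H_cone0 : H_cone A B G 0.
Proof.
apply/H_coneP; split; first by apply/pos_coneP.
by move=> l l0; rewrite -(scale0r 0) (al_functionalZ (defect_linear l0)) mul0r.
Qed.

Lemma minimal_semigroup_M_ideal : M_ideal (H_space A B G) /\
  is_direct_sum (H_space A B G) (disjoint_complement (H_space A B G)).
Proof.
have Hpos : H_cone A B G `<=` pos_cone (R := R) by move=> u [].
split.
  exact: hereditary_cone_M_ideal Hpos H_cone_closed H_cone0 H_coneD H_coneZ
    H_cone_hereditary.
exact: hereditary_cone_direct_sum Hpos H_cone_closed H_cone0 H_coneD H_coneZ
  H_cone_hereditary.
Qed.

End minimal_semigroups.

Theorem proposition3p21 (R : realType) (d : measure_display)
    (Sigma : measurableType d)
    (U V : R -> {linear signed_measure Sigma R -> signed_measure Sigma R})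
    (B : signed_measure Sigma R -> signed_measure Sigma R) :
  let A := generator U in
  let G := generator V in
  substochastic U ->
  linear_on (op_dom A) B ->
  positive_on (op_dom A) B ->
  (forall u, op_dom A u -> pos_cone u -> Psi (A u + B u) <= 0) ->
  minimal_semigroup A B V ->
  M_ideal (H_space A B G) /\
  is_direct_sum (H_space A B G) (disjoint_complement (H_space A B G)).
Proof. exact: minimal_semigroup_M_ideal. Qed.
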